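(* There exists an infinite family $\{M(t)\}_{t\in\mathbb{R}}$ of $12$-dimensional axial algebras of Monster type over $\mathbb{R}$, namely the specialisations $M(t)$ of $M_{4A}$. If $t\notin\{0,\frac16,\frac94\}$ then the algebra $M(t)$ is simple. Otherwise, if $t\in\{0,\frac16\}$ then $M(t)$ contains a $3$-dimensional ideal, and if $t=\frac94$ then $M(t)$ contains a $5$-dimensional ideal.
   Context: Algebras are commutative but not necessarily associative, over a commutative ring $R$ with $1$ containing $\mathbb{R}$ as a subfield. For an idempotent $a\in V$ and $\lambda\in R$ put $V_\lambda^{(a)}=\{v\in V: a\cdot v=\lambda v\}$, and for $\Lambda\subseteq R$ put $V_\Lambda^{(a)}=\bigoplus_{\lambda\in\Lambda}V_\lambda^{(a)}$ ($V_\emptyset^{(a)}=0$). The Monster fusion rule $(\mathcal{M},* )$ has $\mathcal{M}=\{1,0,\frac14,\frac1{32}\}$ and symmetric $*$ with $1*1=\{1\}$, $1*0=\emptyset$, $0*0=\{0\}$, $1*\frac14=0*\frac14=\{\frac14\}$, $\frac14*\frac14=\{1,0\}$, $\lambda*\frac1{32}=\{\frac1{32}\}$ for $\lambda\in\{1,0,\frac14\}$, $\frac1{32}*\frac1{32}=\{1,0,\frac14\}$. An idempotent $a$ is an $(\mathcal{M},* )$-axis if $V=\bigoplus_{\lambda\in\mathcal{M}}V_\lambda^{(a)}$ and $V_\lambda^{(a)}\cdot V_\mu^{(a)}\subseteq V_{\lambda*\mu}^{(a)}$ for all $\lambda,\mu\in\mathcal{M}$; it is primitive if $V_1^{(a)}=Ra$.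 An axial algebra of Monster type is an algebra generated by a set of $(\mathcal{M},* )$-axes. A primitive Frobenius $(\mathcal{M},* )$-axial algebra is an algebra generated by a set $A$ of primitive $(\mathcal{M},* )$-axes with a Frobenius form, i.e. a nonzero $R$-bilinear form $\langle\,,\rangle$ with $\langle u,v\cdot w\rangle=\langle u\cdot v,w\rangle$, normalised by $\langle a,a\rangle=1$ for axes $a\in A$. The Miyamoto involution $\tau(a)$ acts as $1$ on $V_1^{(a)}\oplus V_0^{(a)}\oplus V_{1/4}^{(a)}$ and as $-1$ on $V_{1/32}^{(a)}$. Property $\mathcal{P}$: $A=\{a_1,a_{-1},a_2,a_{-2},a_3,a_{-3}\}$ and on $A$, $\tau(a_1)=\tau(a_{-1})=(a_2,a_{-2})(a_3,a_{-3})$, $\tau(a_2)=\tau(a_{-2})=(a_1,a_{-1})(a_3,a_{-3})$, $\tau(a_3)=\tau(a_{-3})=(a_1,a_{-1})(a_2,a_{-2})$. Shape $4A$: for all distinct $i,j\in\{1,2,3\}$ the subalgebra $\langle\langle a_i,a_j\rangle\rangle$ generated by $a_i,a_j$ is of type $4A$, i.e. it is spanned by $a_{\pm i},a_{\pm j}$ and an idempotent $v=v_{(i,j)}=v_{(j,i)}$ such that, for all signs $\epsilon,\delta$: $a_{\epsilon i}\cdot a_{\delta j}=\frac1{64}(3a_{\epsilon i}+3a_{\delta j}+a_{-\epsilon i}+a_{-\delta j}-3v)$, $a_{\epsilon i}\cdot v=\frac1{16}(5a_{\epsilon i}-a_{-\epsilon i}-2a_j-2a_{-j}+3v)$, $a_{\delta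 j}\cdot v=\frac1{16}(5a_{\delta j}-a_{-\delta j}-2a_i-2a_{-i}+3v)$, $a_i\cdot a_{-i}=a_j\cdot a_{-j}=0$, $\langle a_{\epsilon i},a_{\delta j}\rangle=\frac1{32}$, $\langle a_i,a_{-i}\rangle=\langle a_j,a_{-j}\rangle=0$, $\langle a_{\epsilon i},v\rangle=\langle a_{\delta j},v\rangle=\frac38$, $\langle v,v\rangle=2$. Universal algebra: let $\hat X$ be the free commutative non-associative magma on $\hat a_{\pm1},\hat a_{\pm2},\hat a_{\pm3}$; let $\sim$ be the equivalence relation on $\hat X\times\hat X$ generated by $(\hat x\cdot\hat y,\hat z)\sim(\hat x,\hat y\cdot\hat z)$; let $\hat R=\mathbb{R}[\lambda_{[\hat x,\hat y]}]$ be the polynomial ring with one indeterminate for each $\sim$-class; let $\hat M=\hat R\hat X$ be the algebra of formal $\hat R$-linear combinations of elements of $\hat X$, with $\hat R$-bilinear form $\langle\hat x,\hat y\rangle=\lambda_{[\hat x,\hat y]}$. For ideals $I$ of $\hat M$ and $J\ne\hat R$ of $\hat R$ with $J\hat M\subseteq I$ and $\langle I,\hat M\rangle\subseteq J$, the quotient $\hat M/I$ is an algebra with form over its coefficient ring $\hat R/J$, with marked generators $a_{\pm i}$ the images of $\hat a_{\pm i}$. Let $\mathcal{C}_{4A}$ be the class of such quotients which are primitive Frobenius $(\mathcal{M},* )$-axial algebras (with axes the marked generators) satisfying property $\mathcal{P}$ and having shape $4A$. $M_{4A}$ denotes the universal member of $\mathcal{C}_{4A}$ (given by the smallest pair $(I,J)$;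 all members of $\mathcal{C}_{4A}$ are quotients of it), and $R_{4A}=\hat R/J$ its coefficient ring. Specialisation: the coefficient ring $R_{4A}$ is the polynomial ring $\mathbb{R}[t]$ in $t=\langle a_1,v_{(2,3)}\rangle$. For a real number $t_0$, $M(t_0)$ denotes the real algebra $M_{4A}/(t-t_0)M_{4A}$ obtained by letting $t$ take the value $t_0$, with axes the images of $a_{\pm1},a_{\pm2},a_{\pm3}$ and with the induced form. *)

(* Defs.v *)
From HB Require Import structures.
From Stdlib Require Import Relation_Operators.
From mathcomp Require Import all_boot all_order all_algebra.
From mathcomp Require Import boolp classical_sets reals.
From mathcomp Require Import finmap monalg.

Set Implicit Arguments.
Unset Strict Implicit.
Unset Printing Implicit Defensive.

Import GRing.Theory Num.Theory.

Local Open Scope ring_scope.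
Local Open Scope classical_set_scope.
Local Open Scope quotient_scope.

Inductive monster_ev := Ev1 | Ev0 | Ev4 | Ev32.

Definition monster_all : seq monster_ev := [:: Ev1; Ev0; Ev4; Ev32].

Definition ev_val (R : realType) (l : monster_ev) : R :=
  match l with Ev1 => 1 | Ev0 => 0 | Ev4 => 4^-1 | Ev32 => 32^-1 end.

Definition fusion (l m : monster_ev) : seq monster_ev :=
  match l, m with
  | Ev32, Ev32 => [:: Ev1; Ev0; Ev4]
  | Ev32, _ | _, Ev32 => [:: Ev32]
  | Ev4, Ev4 => [:: Ev1; Ev0]
  | Ev4, _ | _, Ev4 => [:: Ev4]
  | Ev1, Ev1 => [:: Ev1]
  | Ev0, Ev0 => [:: Ev0]
  | _, _ => [::]
  end.

(** The index [(k, s)] stands for a_{k+1} if [s] is [true], for a_{-(k+1)}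
    if [s] is [false]. *)

Notation gen := ('I_3 * bool)%type.

Definition i1 : 'I_3 := @Ordinal 3 0 isT.
Definition i2 : 'I_3 := @Ordinal 3 1 isT.
Definition i3 : 'I_3 := @Ordinal 3 2 isT.

(** [S] is the coefficient ring; since it is nontrivial, [iota] exhibits the
    reals as a subfield of it. *)

Section Axial.
Variables (R : realType) (S : comNzRingType) (iota : {rmorphism R -> S}).
Variables (V : lmodType S) (mul : V -> V -> V).

Definition comm_algebra : Prop :=
  [/\ forall u v, mul u v = mul v u,
      forall u v w, mul (u + v) w = mul u w + mul v w
    & forall c u v, mul (c *: u) v = c *: mul u v].

Definition subalgebra (P : V -> Prop) : Prop :=
  [/\ P 0, forall u v, P u -> P v -> P (u + v),
      forall c u, P u -> P (c *: u)
    & forall u v, P u -> P v -> P (mul u v)].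

Definition generated (X : V -> Prop) (v : V) : Prop :=
  forall P, subalgebra P -> (forall x, X x -> P x) -> P v.

Definition eigen (a : V) (l : monster_ev) (v : V) : Prop :=
  mul a v = iota (ev_val R l) *: v.

Definition eigen_sum (a : V) (L : seq monster_ev) (v : V) : Prop :=
  exists f : monster_ev -> V,
    (forall l, eigen a l (f l)) /\ v = \sum_(l <- L) f l.

Definition is_axis (a : V) : Prop :=
  [/\ mul a a = a,
      forall v, eigen_sum a monster_all v,
      forall f : monster_ev -> V, (forall l, eigen a l (f l)) ->
        \sum_(l <- monster_all) f l = 0 -> forall l, f l = 0
    & forall l m u v, eigen a l u -> eigen a m v ->
        eigen_sum a (fusion l m) (mul u v)].

Definition primitive_axis (a : V) : Prop :=
  forall v, eigen a Ev1 v <-> exists c, v = c *: a.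

(** The graph of the Miyamoto involution of [a]. *)
Definition miyamoto (a v w : V) : Prop :=
  exists u z, [/\ eigen_sum a [:: Ev1; Ev0; Ev4] u, eigen a Ev32 z,
                  v = u + z & w = u - z].

Variable (ax : gen -> V).

Definition monster_axial : Prop :=
  [/\ comm_algebra, forall g, is_axis (ax g)
    & forall v, generated (fun x => exists g, x = ax g) v].

Variable (form : V -> V -> S).

Definition frobenius_form : Prop :=
  [/\ forall c u v w, form (c *: u + v) w = c * form u w + form v w,
      forall c u v w, form w (c *: u + v) = c * form w u + form w v,
      forall u v w, form u (mul v w) = form (mul u v) w
    & exists u v, form u v <> 0].

Definition primitive_frobenius_axial : Prop :=
  [/\ monster_axial, forall g, primitive_axis (ax g), frobenius_form
    & forall g, form (ax g) (ax g) = 1].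

Definition propertyP : Prop :=
  forall (i j : 'I_3) (e d : bool),
    miyamoto (ax (i, e)) (ax (j, d)) (ax (j, if j == i then d else ~~ d)).

Definition type4A (i j : 'I_3) (v : V) : Prop :=
  [/\ forall x,
        generated (fun y => y = ax (i, true) \/ y = ax (j, true)) x <->
        exists c1 c2 c3 c4 c5,
          x = c1 *: ax (i, true) + c2 *: ax (i, false)
            + c3 *: ax (j, true) + c4 *: ax (j, false) + c5 *: v,
      mul v v = v,
      (forall e d, mul (ax (i, e)) (ax (j, d)) = iota 64^-1 *:
         (ax (i, e) *+ 3 + ax (j, d) *+ 3 + ax (i, ~~ e) + ax (j, ~~ d)
          - v *+ 3)) /\
      (forall e, mul (ax (i, e)) v = iota 16^-1 *:
         (ax (i, e) *+ 5 - ax (i, ~~ e) - ax (j, true) *+ 2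
          - ax (j, false) *+ 2 + v *+ 3)) /\
      (forall d, mul (ax (j, d)) v = iota 16^-1 *:
         (ax (j, d) *+ 5 - ax (j, ~~ d) - ax (i, true) *+ 2
          - ax (i, false) *+ 2 + v *+ 3)),
      mul (ax (i, true)) (ax (i, false)) = 0 /\
      mul (ax (j, true)) (ax (j, false)) = 0
    & [/\ forall e d, form (ax (i, e)) (ax (j, d)) = iota 32^-1,
          form (ax (i, true)) (ax (i, false)) = 0 /\
          form (ax (j, true)) (ax (j, false)) = 0,
          forall e, form (ax (i, e)) v = iota (3 / 8),
          forall d, form (ax (j, d)) v = iota (3 / 8)
        & form v v = 2]].

Definition shape4A : Prop :=
  exists v : 'I_3 -> 'I_3 -> V, (forall i j, v i j = v j i) /\
    forall i j, i != j -> type4A i j (v i j).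

End Axial.

Inductive tree := Leaf of gen | Node of tree & tree.

Fixpoint tree_code (x : tree) : GenTree.tree gen :=
  match x with
  | Leaf g => GenTree.Leaf g
  | Node x y => GenTree.Node 0 [:: tree_code x; tree_code y]
  end.

Fixpoint tree_decode (c : GenTree.tree gen) : option tree :=
  match c with
  | GenTree.Leaf g => Some (Leaf g)
  | GenTree.Node _ [:: c; d] =>
      if (tree_decode c, tree_decode d) is (Some x, Some y)
      then Some (Node x y) else None
  | _ => None
  end.

Lemma tree_codeK : pcancel tree_code tree_decode.
Proof. by elim=> //= x -> y ->. Qed.

HB.instance Definition _ := Countable.copy tree (pcan_type tree_codeK).

(** Equality of trees up to swapping the two branches at any nodes. *)
Fixpoint tree_eqv (x y : tree) : bool :=
  match x, y with
  | Leaf g, Leaf h => g == h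
  | Node x1 x2, Node y1 y2 =>
      (tree_eqv x1 y1 && tree_eqv x2 y2) || (tree_eqv x1 y2 && tree_eqv x2 y1)
  | _, _ => false
  end.

Lemma tree_eqv_refl : reflexive tree_eqv.
Proof. by elim=> [g|x IHx y IHy] /=; rewrite ?eqxx // IHx IHy. Qed.

Lemma tree_eqv_sym : symmetric tree_eqv.
Proof.
elim=> [g|x1 IH1 x2 IH2] [h|y1 y2] //=.
by rewrite !IH1 !IH2 [tree_eqv y2 x1 && _]andbC.
Qed.

Lemma tree_eqv_trans : transitive tree_eqv.
Proof.
move=> y x z; elim: y x z => [g|y1 IH1 y2 IH2] [h|x1 x2] [k|z1 z2] //=.
  by move=> /eqP-> /eqP->.
by case/orP=> /andP[a b] /orP[] /andP[c d]; apply/orP;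
  [left|right|right|left]; apply/andP; split; eauto.
Qed.

Canonical tree_equiv :=
  EquivRel tree_eqv tree_eqv_refl tree_eqv_sym tree_eqv_trans.

Definition magma := {eq_quot tree_eqv}.
HB.instance Definition _ := Choice.on magma.
HB.instance Definition _ := EqQuotient.on magma.

Definition magma_gen (g : gen) : magma := \pi_magma (Leaf g).
Definition magma_mul (x y : magma) : magma :=
  \pi_magma (Node (repr x) (repr y)).

Inductive assoc_step : magma * magma -> magma * magma -> Prop :=
  AssocStep x y z : assoc_step (magma_mul x y, z) (x, magma_mul y z).

Definition assoc_eqv (p q : magma * magma) : bool :=
  `[< clos_refl_sym_trans _ assoc_step p q >].

Lemma assoc_eqv_refl : reflexive assoc_eqv.
Proof. by move=> p; apply/asboolP; apply: rst_refl. Qed.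

Lemma assoc_eqv_sym : symmetric assoc_eqv.
Proof. by move=> p q; apply/asboolP/asboolP; apply: rst_sym. Qed.

Lemma assoc_eqv_trans : transitive assoc_eqv.
Proof.
by move=> q p r /asboolP pq /asboolP qr; apply/asboolP; apply: rst_trans qr.
Qed.

Canonical assoc_equiv :=
  EquivRel assoc_eqv assoc_eqv_refl assoc_eqv_sym assoc_eqv_trans.

Definition lambda_index := {eq_quot assoc_eqv}.
HB.instance Definition _ := Choice.on lambda_index.
HB.instance Definition _ := EqQuotient.on lambda_index.

Notation Rhat R := {malg R[{cmonom lambda_index}]}.
Notation Mhat R := {malg (Rhat R)[magma]}.

Section Universal.
Variable R : realType.

Definition lambda (x y : magma) : Rhat R :=
  << ucm (\pi_lambda_index (x, y)) >>.

Definition Mgen (g : gen) : Mhat R := << magma_gen g >>.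

Definition Mmul (u v : Mhat R) : Mhat R :=
  \sum_(x <- msupp u) \sum_(y <- msupp v) << u@_x * v@_y *g magma_mul x y >>.

Definition Mform (u v : Mhat R) : Rhat R :=
  \sum_(x <- msupp u) \sum_(y <- msupp v) u@_x * v@_y * lambda x y.

Definition ideal_pair (I : set (Mhat R)) (J : set (Rhat R)) : Prop :=
  [/\ [/\ I 0, forall u v, I u -> I v -> I (u + v),
          forall c u, I u -> I (c *: u)
        & forall u v, I u -> I (Mmul u v) /\ I (Mmul v u)],
      [/\ J 0, forall r s, J r -> J s -> J (r + s),
          forall c r, J r -> J (c * r)
        & exists r, ~ J r],
      forall r u, J r -> I (r *: u)
    & forall u v, I u -> J (Mform u v)].

Record form_algebra := FormAlgebra {
  fa_ring : comNzRingType;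
  fa_real : {rmorphism R -> fa_ring};
  fa_sort :> lmodType fa_ring;
  fa_mul : fa_sort -> fa_sort -> fa_sort;
  fa_form : fa_sort -> fa_sort -> fa_ring;
  fa_ax : gen -> fa_sort }.

(** [Q] is the quotient of [Mhat R] by [I] over the quotient of [Rhat R] by
    [J]; quotients are given by their projections. *)
Definition quotient_by (Q : form_algebra) (I : set (Mhat R))
    (J : set (Rhat R)) : Prop :=
  exists (pR : {rmorphism Rhat R -> fa_ring Q}) (pM : Mhat R -> Q),
  [/\ [/\ forall s, exists r, pR r = s, forall r, pR r = 0 <-> J r
        & forall c : R, pR c%:MP = fa_real Q c],
      [/\ forall r u v, pM (r *: u + v) = pR r *: pM u + pM v,
          forall x, exists u, pM u = x & forall u, pM u = 0 <-> I u],
      forall u v, pM (Mmul u v) = fa_mul (pM u) (pM v),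
      forall u v, fa_form (pM u) (pM v) = pR (Mform u v)
    & forall g, pM (Mgen g) = fa_ax Q g].

Definition type4A_in (Q : form_algebra) : 'I_3 -> 'I_3 -> Q -> Prop :=
  type4A (fa_real Q) (@fa_mul Q) (@fa_ax Q) (@fa_form Q).

Definition in_C4A (I : set (Mhat R)) (J : set (Rhat R)) : Prop :=
  ideal_pair I J /\
  exists Q : form_algebra,
    [/\ quotient_by Q I J,
        primitive_frobenius_axial (fa_real Q) (@fa_mul Q) (@fa_ax Q)
          (@fa_form Q),
        propertyP (fa_real Q) (@fa_mul Q) (@fa_ax Q)
      & shape4A (fa_real Q) (@fa_mul Q) (@fa_ax Q) (@fa_form Q)].

(** [M4A] is determined up to isomorphism, by the least pair of ideals. *)
Definition is_M4A (Q : form_algebra) : Prop :=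
  exists (I : set (Mhat R)) (J : set (Rhat R)),
    [/\ in_C4A I J,
        forall I' J', in_C4A I' J' -> I `<=` I' /\ J `<=` J'
      & quotient_by Q I J].

Record real_algebra := RealAlgebra {
  ra_sort :> vectType R;
  ra_mul : ra_sort -> ra_sort -> ra_sort;
  ra_form : ra_sort -> ra_sort -> R;
  ra_ax : gen -> ra_sort }.

(** [M] is [Q / (t - t0) Q], over the quotient of the coefficient ring of [Q]
    by [t - t0], which is identified with the reals. *)
Definition specialisation (Q : form_algebra) (t : fa_ring Q) (t0 : R)
    (M : real_algebra) : Prop :=
  exists (ev : {rmorphism fa_ring Q -> R}) (p : Q -> M),
  [/\ [/\ forall c, ev (fa_real Q c) = c
        & forall s, ev s = 0 <-> exists c, s = (t - fa_real Q t0) * c],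
      [/\ forall s x y, p (s *: x + y) = ev s *: p x + p y,
          forall z, exists x, p x = z
        & forall x, p x = 0 <-> exists y, x = (t - fa_real Q t0) *: y],
      forall x y, p (fa_mul x y) = ra_mul (p x) (p y),
      forall x y, ra_form (p x) (p y) = ev (fa_form x y)
    & forall g, p (fa_ax Q g) = ra_ax M g].

Definition real_monster_axial (M : real_algebra) : Prop :=
  monster_axial (idfun : {rmorphism R -> R}) (@ra_mul M) (@ra_ax M).

Definition is_ideal (M : real_algebra) (U : {vspace M}) : Prop :=
  forall x y, x \in U -> ra_mul x y \in U /\ ra_mul y x \in U.

Definition simple_algebra (M : real_algebra) : Prop :=
  (exists x y : M, ra_mul x y <> 0) /\
  forall U : {vspace M}, is_ideal U -> U = 0%VS \/ U = fullv.

(** Isomorphism of algebras carrying the set of marked axes of [M] to that of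
    [N], not necessarily preserving the indices. *)
Definition axial_isomorphic (M N : real_algebra) : Prop :=
  exists f : {linear M -> N},
    [/\ bijective f, forall x y, f (ra_mul x y) = ra_mul (f x) (f y),
        forall g, exists h, f (ra_ax M g) = ra_ax N h
      & forall h, exists g, f (ra_ax M g) = ra_ax N h].

End Universal.

(* Main.v *)
(** Put [v_1 = v_(2,3)], ..., [t = <a_1, v_1>] and [y_i = a_i v_i - t a_i].  In a
    member of the class, the eigenvectors of an axis [a] inside the 4A
    subalgebras are known.  If [u] and [w] are eigenvectors of [a] for [0] or
    [1/4], the fusion rule prescribes [a (u w)] (for two [1/4]-eigenvectors
    through the projection of [u w] to [a], which the form computes).  These
    linear relations between products are solved by elimination without ever
    inverting a polynomial in [t]: all products of the twelve vectors
    [a_i, a_{-i}, v_i, y_i] are combinations of these vectors with coefficients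
    in Q[t].  Conversely this multiplication table on the free module of rank 12
    over R[t] satisfies all the axioms, so it is the universal algebra, and M(t)
    is its evaluation at [t].

    M(s) and M(t) are distinguished by [<a_1, a_2 a_3> = (1 - 12 t) / 256], which
    the multiplication determines since the projection to an axis [a] is a
    polynomial in the multiplication by [a].  The same projections show that an
    ideal not orthogonal to all axes contains an axis, hence all axes, hence
    everything; an ideal orthogonal to all axes lies in the radical of the form,
    which is zero unless [t] is 0, 1/6 or 9/4.  The ideals at these three values
    are explicit. *)

From HB Require Import structures.
From Stdlib Require Import Relation_Operators ZArith QArith.
Require Import Defs.
From mathcomp Require Import all_boot all_order all_algebra.
From mathcomp Require Import boolp classical_sets reals.
From mathcomp Require Import finmap monalg.
From mathcomp Require Import ring.
From mathcomp.zify Require Import ssrZ.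

Set Implicit Arguments.
Unset Strict Implicit.
Unset Printing Implicit Defensive.

Import GRing.Theory Num.Theory.

Local Open Scope ring_scope.
Delimit Scope Q_scope with qq.

(** * Computing with linear combinations over Q[t] *)

Lemma pair_of_QK :
  pcancel (fun q => (Qnum q, Zpos (Qden q)))
          (fun x => if x.2 is Zpos d then Some (Qmake x.1 d) else None).
Proof. by case. Qed.

HB.instance Definition _ := Equality.copy Q (pcan_type pair_of_QK).

Definition pol := seq Q.

Definition qadd (a b : Q) : Q := Qred (Qplus a b).
Definition qmul (a b : Q) : Q := Qred (Qmult a b).

Definition pcons (c : Q) (p : pol) : pol :=
  if (nilp p && Qeq_bool c 0%qq) then [::] else c :: p.

Fixpoint padd (p q : pol) : pol :=
  match p, q with
  | [::], _ => q
  | _, [::] => p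
  | a :: p', b :: q' => pcons (qadd a b) (padd p' q')
  end.

Definition pscale (c : Q) (p : pol) : pol :=
  foldr (fun a r => pcons (qmul c a) r) [::] p.

Definition pmul (p q : pol) : pol :=
  foldr (fun a r => padd (pscale a q) (pcons 0%qq r)) [::] p.

Definition pzero (p : pol) : bool := all (Qeq_bool 0%qq) p.

Definition peq (p q : pol) : bool := pzero (padd p (pscale (-1)%qq q)).

(** [[:: i]] stands for the i-th basis element, [i :: s] for its product
    with [s]. *)
Definition sym := seq nat.
Definition vec := seq (sym * pol).

Fixpoint vins (s : sym) (p : pol) (v : vec) : vec :=
  match v with
  | [::] => if pzero p then [::] else [:: (s, p)]
  | (s', q) :: v' =>
      if s == s' then
        let r := padd p q in if pzero r then v' else (s', r) :: v'
      else (s', q) :: vins s p v'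
  end.

Definition vadd (u v : vec) : vec := foldr (fun x r => vins x.1 x.2 r) v u.
Definition vscale (p : pol) (u : vec) : vec := [seq (x.1, pmul p x.2) | x <- u].
Definition vsub (u v : vec) : vec := vadd (vscale [:: (-1)%qq] v) u.
Definition vsum (vs : seq vec) : vec := foldr vadd [::] vs.
Definition veq (u v : vec) : bool := all (fun x => pzero x.2) (vsub u v).
Definition vcoef (s : sym) (u : vec) : pol :=
  foldr (fun x r => if x.1 == s then padd x.2 r else r) [::] u.
Definition bas (i : nat) : vec := [:: ([:: i], [:: 1%qq])].
Arguments vscale : simpl never.
Arguments vsub : simpl never.
Arguments bas : simpl never.

Definition basic (u : vec) : bool := all (fun x => size x.1 == 1) u.

Section Evaluation.
Variables (R : realType) (S : comNzRingType) (iota : {rmorphism R -> S}).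
Variable t : S.

Definition qev (q : Q) : R :=
  (int_of_Z (Qnum q))%:~R / (int_of_Z (Zpos (Qden q)))%:~R.

Lemma int_of_ZM x y : int_of_Z (Z.mul x y) = int_of_Z x * int_of_Z y.
Proof. exact: (rmorphM int_of_Z). Qed.

Lemma int_of_ZD x y : int_of_Z (Z.add x y) = int_of_Z x + int_of_Z y.
Proof. exact: (raddfD int_of_Z). Qed.

Lemma Qden_neq0 q : (int_of_Z (Zpos (Qden q)))%:~R != 0 :> R.
Proof. by rewrite intr_eq0 /= -lt0n; apply/ltP/Pos2Nat.is_pos. Qed.

Lemma qev_eq a b : Qeq a b -> qev a = qev b.
Proof.
rewrite /Qeq => E; apply/eqP; rewrite eqr_div ?Qden_neq0 //.
by rewrite -!intrM -!int_of_ZM E.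
Qed.

Lemma qev0 : qev 0%qq = 0.
Proof. by rewrite /qev /= mul0r. Qed.

Lemma qev1 : qev 1%qq = 1.
Proof. by rewrite /qev /= divr1. Qed.

Lemma qev_add a b : qev (qadd a b) = qev a + qev b.
Proof.
rewrite (qev_eq (Qred_correct _)) /qev /Qplus addf_div ?Qden_neq0 //.
by rewrite -!intrM -intrD -!int_of_ZM -int_of_ZD.
Qed.

Lemma qev_mul a b : qev (qmul a b) = qev a * qev b.
Proof.
rewrite (qev_eq (Qred_correct _)) /qev /Qmult mulf_div.
by rewrite -!intrM -!int_of_ZM.
Qed.

Definition pev (p : pol) : S := foldr (fun c r => iota (qev c) + t * r) 0 p.

Lemma pev_pcons c p : pev (pcons c p) = iota (qev c) + t * pev p.
Proof.
rewrite /pcons; case: p => [|a p] //=.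
case E: (Qeq_bool c 0%qq) => //=.
by rewrite (qev_eq (Qeq_bool_eq _ _ E)) qev0 rmorph0 mulr0 addr0.
Qed.

Lemma pev_add p q : pev (padd p q) = pev p + pev q.
Proof.
elim: p q => [|a p IH] [|b q] //=; rewrite ?add0r ?addr0 //.
by rewrite pev_pcons qev_add IH rmorphD mulrDr addrACA.
Qed.

Lemma pev_scale c p : pev (pscale c p) = iota (qev c) * pev p.
Proof.
elim: p => [|a p IH] /=; first by rewrite mulr0.
by rewrite pev_pcons IH qev_mul rmorphM mulrDr mulrCA.
Qed.

Lemma pev_mul p q : pev (pmul p q) = pev p * pev q.
Proof.
elim: p => [|a p IH] /=; first by rewrite mul0r.
by rewrite pev_add pev_scale pev_pcons IH qev0 rmorph0 add0r mulrDl mulrA.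
Qed.

Lemma pev_zero p : pzero p -> pev p = 0.
Proof.
elim: p => //= a p IH /andP[/Qeq_bool_eq Ea /IH ->].
by rewrite -(qev_eq Ea) qev0 rmorph0 mulr0 addr0.
Qed.

Lemma pevC c : pev [:: c] = iota (qev c).
Proof. by rewrite /= mulr0 addr0. Qed.

Lemma pev1 : pev [:: 1%qq] = 1.
Proof. by rewrite pevC qev1 rmorph1. Qed.

Lemma pevN1 : pev [:: (-1)%qq] = -1.
Proof. by rewrite pevC /qev /= divr1 rmorphN1. Qed.

Lemma pev_lin q : pev [:: 0%qq; q] = t * iota (qev q).
Proof. by rewrite /= qev0 rmorph0 add0r mulr0 addr0. Qed.

Lemma peq_pev p q : peq p q -> pev p = pev q.
Proof.
move/pev_zero/eqP; rewrite pev_add pev_scale -pevC pevN1 mulN1r subr_eq0.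
by move/eqP.
Qed.

Lemma pev_linN : pev [:: 0%qq; (-1)%qq] = - t.
Proof. by rewrite pev_lin -pevC pevN1 mulrN1. Qed.

Section Valuation.
Variables (V : lmodType S) (val : sym -> V).

Definition vev (u : vec) : V := \sum_(x <- u) pev x.2 *: val x.1.

Lemma vev_nil : vev [::] = 0. Proof. exact: big_nil. Qed.

Lemma vev_cons x u : vev (x :: u) = pev x.2 *: val x.1 + vev u.
Proof. exact: big_cons. Qed.

Lemma vev_ins s p u : vev (vins s p u) = pev p *: val s + vev u.
Proof.
elim: u => [|[s' q] u IH] /=.
  by case: ifP => [/pev_zero->|_]; rewrite ?scale0r ?vev_nil ?addr0 ?vev_cons
    ?vev_nil ?addr0.
case: eqP => [->|_]; last by rewrite !vev_cons IH addrCA.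
rewrite vev_cons /= addrA -scalerDl -pev_add.
by case: ifP => [/pev_zero->|_]; rewrite ?scale0r ?add0r ?vev_cons.
Qed.

Lemma vev_add u v : vev (vadd u v) = vev u + vev v.
Proof.
elim: u => [|x u IH] /=; first by rewrite vev_nil add0r.
by rewrite vev_ins IH vev_cons addrA.
Qed.

Lemma vev_scale p u : vev (vscale p u) = pev p *: vev u.
Proof.
elim: u => [|x u IH] /=; first by rewrite vev_nil scaler0.
by rewrite !vev_cons IH pev_mul scalerDr scalerA.
Qed.

Lemma vev_sub u v : vev (vsub u v) = vev u - vev v.
Proof. by rewrite /vsub vev_add vev_scale pevN1 scaleN1r addrC. Qed.

Lemma vev_sum vs : vev (vsum vs) = \sum_(v <- vs) vev v.
Proof.
elim: vs => [|v vs IH]; first by rewrite big_nil vev_nil.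
by rewrite big_cons /= vev_add IH.
Qed.

Lemma vev_zero u : all (fun x => pzero x.2) u -> vev u = 0.
Proof.
elim: u => [|x u IH] /=; first by rewrite vev_nil.
by case/andP=> /pev_zero Ex /IH Eu; rewrite vev_cons Ex Eu scale0r addr0.
Qed.

Lemma vev_eq u v : veq u v -> vev u = vev v.
Proof. by move/vev_zero/eqP; rewrite vev_sub subr_eq0 => /eqP. Qed.

Lemma vev_bas i : vev (bas i) = val [:: i].
Proof. by rewrite vev_cons vev_nil addr0 pev1 scale1r. Qed.

End Valuation.
End Evaluation.

Arguments padd : simpl never.
Arguments pmul : simpl never.
Arguments pscale : simpl never.

(** * Elimination for products *)

Definition flat_map (A B : Type) (s : seq A) (f : A -> seq B) : seq B :=
  flatten [seq f x | x <- s].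

Definition assoc_list (A : Type) := seq ((nat * nat) * A).

Fixpoint find_entry (A : Type) (l : assoc_list A) (k : nat * nat) : option A :=
  if l is x :: l' then if x.1 == k then Some x.2 else find_entry l' k else None.

Definition lookup (A : Type) (l : assoc_list A) (i j : nat) : option A :=
  find_entry l (minn i j, maxn i j).

Definition table := assoc_list vec.
Definition gram := assoc_list pol.

Definition mul_sym (tab : table) (g : nat) (s : sym) : vec :=
  match s with
  | [::] => [::]
  | [:: i] => if lookup tab g i is Some r then r
              else [:: ([:: minn g i; maxn g i], [:: 1%qq])]
  | _ => [:: (g :: s, [:: 1%qq])]
  end.

Definition ad (tab : table) (g : nat) (u : vec) : vec :=
  vsum [seq vscale x.2 (mul_sym tab g x.1) | x <- u].

Definition vmul (tab : table) (u w : vec) : vec :=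
  vsum [seq vscale x.2 (ad tab (head 0%N x.1) w) | x <- u].

Definition osum (s : seq (option pol)) : option pol :=
  foldr (fun a b => if (a, b) is (Some a, Some b) then Some (padd a b) else None)
    (Some [::]) s.

Definition gform (gt : gram) (u w : vec) : option pol :=
  if basic u && basic w then
    osum [seq omap (pmul (pmul x.2 y.2))
                (lookup gt (head 0%N x.1) (head 0%N y.1)) | x <- u, y <- w]
  else None.

Definition evq (l : monster_ev) : Q :=
  match l with
  | Ev1 => 1%qq | Ev0 => 0%qq | Ev4 => (1 # 4)%qq | Ev32 => (1 # 32)%qq
  end.

Definition is_eigen (tab : table) (g : nat) (x : monster_ev * vec) : bool :=
  basic x.2 && veq (ad tab g x.2) (vscale [:: evq x.1] x.2).

Definition fusion_rel (tab : table) (gt : gram) (g : nat)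
    (x y : monster_ev * vec) : seq vec :=
  if is_eigen tab g x && is_eigen tab g y then
    let p := vmul tab x.2 y.2 in
    let q := ad tab g p in
    match x.1, y.1 with
    | Ev0, Ev0 => [:: q]
    | Ev0, Ev4 | Ev4, Ev0 => [:: vsub q (vscale [:: (1 # 4)%qq] p)]
    | Ev4, Ev4 => if gform gt x.2 y.2 is Some c
        then [:: vsub q (vscale (pscale (1 # 4)%qq c) (bas g))] else [::]
    | _, _ => [::]
    end
  else [::].

Fixpoint pairs (A : Type) (s : seq A) : seq (A * A) :=
  if s is x :: s' then [seq (x, y) | y <- s] ++ pairs s' else [::].

Definition fusion_rels (eigs : nat -> seq (monster_ev * vec)) (tab : table)
    (gt : gram) : seq vec :=
  flat_map (iota 0 6) (fun g => flat_map (pairs (eigs g)) (fun x =>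
    fusion_rel tab gt g x.1 x.2)).

(** Gaussian elimination; only coefficients that are nonzero constants are
    used as pivots, so that no polynomial in [t] is ever inverted. *)
Definition reduce1 (kq : sym * vec) (r : vec) : vec :=
  let c := vcoef kq.1 r in if pzero c then r else vsub r (vscale c kq.2).

Definition pick_pivot (ok : sym -> bool) (r : vec) : option sym :=
  foldl (fun o x =>
    if ok x.1 && (size x.2 == 1) && ~~ pzero x.2 then
      if o is Some s then if (size s < size x.1)%N then Some x.1 else o
      else Some x.1
    else o) None r.

Definition elim1 ok (pivs : seq (sym * vec)) (r : vec) : seq (sym * vec) :=
  let r' := foldl (fun r kq => reduce1 kq r) r pivs in
  if pick_pivot ok r' is Some k then
    let kq := (k, vscale [:: Qinv (head 0%qq (vcoef k r'))] r') in
    kq :: [seq (x.1, reduce1 kq x.2) | x <- pivs]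
  else pivs.

Definition eliminate ok (rows : seq vec) : seq (sym * vec) :=
  foldl (elim1 ok) [::] rows.

Definition learn (kq : sym * vec) : table :=
  if kq.1 is [:: i; j] then
    let r := vscale [:: (-1)%qq] [seq x <- kq.2 | x.1 != kq.1] in
    if basic r && veq (vsub [:: (kq.1, [:: 1%qq])] r) kq.2
    then [:: ((i, j), r)] else [::]
  else [::].

Definition step eigs (gt : gram) (tab : table) : table :=
  flat_map (eliminate (fun s => 1 < size s)%N (fusion_rels eigs tab gt)) learn
  ++ tab.

Definition apos (i : nat) (s : bool) : nat := (i.*2 + ~~ s)%N.
Definition vpos (i : nat) : nat := (6 + i)%N.
Definition ypos (i : nat) : nat := (9 + i)%N.

Definition cst (q : Q) (n : nat) : sym * pol := ([:: n], [:: q]).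
Definition tms (q : Q) (n : nat) : sym * pol := ([:: n], [:: 0%qq; q]).

(** <y_i, z> = <p, q z> - t <a_i, z> whenever {p, q} = {a_i, v_i}. *)
Definition gram_entry (tab : table) (gt : gram) (i j p q : nat) : gram :=
  if (gform gt (bas p) (ad tab q (bas j)), lookup gt (apos i true) j)
    is (Some a, Some b)
  then [:: ((minn (ypos i) j, maxn (ypos i) j),
            padd a (pmul [:: 0%qq; (-1)%qq] b))]
  else [::].

Definition gram_step (tab : table) (gt : gram) : gram :=
  flat_map (iota 0 3) (fun i => flat_map (iota 0 12) (fun j =>
    if lookup gt (ypos i) j is Some _ then [::] else
    if gram_entry tab gt i j (apos i true) (vpos i) is x :: _ then [:: x]
    else gram_entry tab gt i j (vpos i) (apos i true))) ++ gt.

Definition others (i : nat) : seq (nat * nat) :=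
  nth [::] [:: [:: (1, 2); (2, 1)]; [:: (0, 2); (2, 0)]; [:: (0, 1); (1, 0)]] i.

Definition eigs_4A (g : nat) : seq (monster_ev * vec) :=
  let i := g./2 in let s := ~~ odd g in
  (Ev0, bas (apos i (~~ s))) :: flat_map (others i) (fun jk =>
  [:: (Ev0, [:: cst 1 (vpos jk.2); cst 2 (apos jk.1 true);
                cst 2 (apos jk.1 false);
                cst (-1 # 2) g]);
      (Ev4, [:: cst 1 (vpos jk.2); cst (-2 # 3) (apos jk.1 true);
                cst (-2 # 3) (apos jk.1 false); cst (-1 # 3) (apos i true);
                cst (-1 # 3) (apos i false)])]).

Definition eigs_full (g : nat) : seq (monster_ev * vec) :=
  let i := g./2 in let jk := head (0%N, 0%N) (others i) in
  eigs_4A g ++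
  [:: (Ev0, [:: cst 1 (vpos i); cst (-4) (ypos i); tms (-1) g]);
      (Ev0, [:: cst 1 (ypos jk.1); cst 1 (ypos jk.2); tms (-1 # 4) (vpos jk.1);
                tms (-1 # 4) (vpos jk.2); cst (-1 # 8) (vpos i)]);
      (Ev4, bas (ypos i));
      (Ev4, [:: cst 1 (ypos jk.1); cst (-1) (ypos jk.2); tms (3 # 4) (vpos jk.2);
                tms (-3 # 4) (vpos jk.1)]);
      (Ev32, [:: cst 1 (apos jk.1 true); cst (-1) (apos jk.1 false)]);
      (Ev32, [:: cst 1 (apos jk.2 true); cst (-1) (apos jk.2 false)]);
      (Ev1, bas g)].

Definition entry (A : Type) (i j : nat) (x : A) : assoc_list A :=
  [:: ((minn i j, maxn i j), x)].

Definition signs : seq bool := [:: true; false].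

Definition axax_vec (a b a' b' v : nat) : vec :=
  [:: cst (3 # 64) a; cst (3 # 64) b; cst (1 # 64) a'; cst (1 # 64) b';
      cst (-3 # 64) v].

Definition axv_vec (a a' b b' v : nat) : vec :=
  [:: cst (5 # 16) a; cst (-1 # 16) a'; cst (-1 # 8) b; cst (-1 # 8) b';
      cst (3 # 16) v].

Definition table0 : table :=
  flat_map (iota 0 3) (fun i => flat_map signs (fun d =>
    entry (apos i d) (apos i d) (bas (apos i d)))) ++
  flat_map (iota 0 3) (fun i => entry (apos i true) (apos i false) [::]) ++
  flat_map (iota 0 3) (fun i => flat_map (others i) (fun jk =>
    flat_map signs (fun d => flat_map signs (fun s =>
      entry (apos i d) (apos jk.1 s)
        (axax_vec (apos i d) (apos jk.1 s) (apos i (~~ d)) (apos jk.1 (~~ s))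
          (vpos jk.2)))))) ++
  flat_map (iota 0 3) (fun i => flat_map (others i) (fun jk =>
    flat_map signs (fun d =>
      entry (apos i d) (vpos jk.2)
        (axv_vec (apos i d) (apos i (~~ d)) (apos jk.1 true) (apos jk.1 false)
          (vpos jk.2))))) ++
  flat_map (iota 0 3) (fun i => entry (vpos i) (vpos i) (bas (vpos i))) ++
  flat_map (iota 0 3) (fun i =>
    entry (apos i true) (vpos i) [:: cst 1 (ypos i); tms 1 (apos i true)]).

Definition gram0 : gram :=
  flat_map (iota 0 3) (fun i => flat_map signs (fun d =>
    entry (apos i d) (apos i d) [:: 1%qq])) ++
  flat_map (iota 0 3) (fun i => entry (apos i true) (apos i false) [::]) ++
  flat_map (iota 0 3) (fun i => flat_map (others i) (fun jk =>
    flat_map signs (fun d => flat_map signs (fun s =>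
      entry (apos i d) (apos jk.1 s) [:: (1 # 32)%qq])))) ++
  flat_map (iota 0 3) (fun i => flat_map (others i) (fun jk =>
    flat_map signs (fun d => entry (apos i d) (vpos jk.2) [:: (3 # 8)%qq]))) ++
  flat_map (iota 0 3) (fun i => flat_map signs (fun d =>
    entry (apos i d) (vpos i) [:: 0%qq; 1%qq])) ++
  flat_map (iota 0 3) (fun i => entry (vpos i) (vpos i) [:: 2%qq]) ++
  flat_map (iota 0 3) (fun i => flat_map (others i) (fun jk =>
    entry (vpos jk.1) (vpos jk.2) [:: (1 # 2)%qq; (-8 # 3)%qq])).

Definition table_4A : table := iter 2 (step eigs_4A gram0) table0.
Definition full_gram_def : gram := iter 3 (gram_step table_4A) gram0.
Definition full_table_def : table :=
  iter 2 (step eigs_full full_gram_def) table_4A.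

Definition full_gram : gram := Eval vm_compute in full_gram_def.
Definition full_table : table := Eval vm_compute in full_table_def.

Lemma full_gramE : full_gram_def = full_gram.
Proof. by vm_cast_no_check (erefl full_gram). Qed.

Lemma full_tableE : full_table_def = full_table.
Proof. by vm_cast_no_check (erefl full_table). Qed.

Lemma in_flat_map (A B : Type) (f : A -> seq B) s (P : B -> Prop) :
  (forall x, List.In x s -> forall y, List.In y (f x) -> P y) ->
  forall y, List.In y (flat_map s f) -> P y.
Proof.
rewrite /flat_map; elim: s => //= x s IH H y /List.in_app_iff[].
  by apply: H; left.
by apply: IH => z zs; apply: H; right.
Qed.

Lemma in_map_ind (A B : Type) (f : A -> B) s (P : B -> Prop) :
  (forall x, List.In x s -> P (f x)) -> forall y, List.In y (map f s) -> P y.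
Proof.
by elim: s => //= x s IH H y [<-|]; [apply: H; left
  |apply: IH => z zs; apply: H; right].
Qed.

Lemma in_cat_ind (A : Type) (s1 s2 : seq A) (P : A -> Prop) :
  (forall x, List.In x s1 -> P x) -> (forall x, List.In x s2 -> P x) ->
  forall x, List.In x (s1 ++ s2) -> P x.
Proof. by move=> H1 H2 x /List.in_app_iff[/H1|/H2]. Qed.

Lemma find_entry_in (A : Type) (l : assoc_list A) k r :
  find_entry l k = Some r -> List.In (k, r) l.
Proof.
elim: l => //= -[k' r'] l IH /=; case: eqP => [-> [->]|_ /IH]; first by left.
by right.
Qed.

Lemma in_iota i m n : List.In i (iota m n) -> (m <= i < m + n)%N.
Proof.
by move=> H; rewrite -mem_iota; elim: n m H => //= n IH m [->|/IH];
  rewrite in_cons ?eqxx // => ->; rewrite orbT.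
Qed.

Section Algebra.
Variables (R : realType) (S : comNzRingType) (iota : {rmorphism R -> S}).
Variables (t : S) (V : lmodType S) (mul : V -> V -> V).
Hypothesis mulP : comm_algebra mul.

Lemma amulC u v : mul u v = mul v u. Proof. by case: mulP. Qed.
Lemma amulDl u v w : mul (u + v) w = mul u w + mul v w.
Proof. by case: mulP. Qed.
Lemma amulZl c u v : mul (c *: u) v = c *: mul u v. Proof. by case: mulP. Qed.
Lemma amulDr u v w : mul w (u + v) = mul w u + mul w v.
Proof. by rewrite !(amulC w) amulDl. Qed.
Lemma amulZr c u v : mul u (c *: v) = c *: mul u v.
Proof. by rewrite !(amulC u) amulZl. Qed.
Lemma amul0l v : mul 0 v = 0.
Proof. by have := amulZl 0 0 v; rewrite !scale0r. Qed.
Lemma amul0r v : mul v 0 = 0.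
Proof. by rewrite amulC amul0l. Qed.
Variable e : nat -> V.

Fixpoint sev (s : sym) : V :=
  match s with
  | [::] => 0
  | [:: i] => e i
  | i :: s' => mul (e i) (sev s')
  end.

Local Notation pev := (pev iota t).
Local Notation vev := (vev iota t sev).

Definition table_valid (tab : table) : Prop :=
  forall x, List.In x tab -> mul (e x.1.1) (e x.1.2) = vev x.2.

Section Table.
Variable tab : table.
Hypothesis tabP : table_valid tab.

Lemma minmax_mul i j : mul (e (minn i j)) (e (maxn i j)) = mul (e i) (e j).
Proof. by case: (leqP i j) => // _; rewrite amulC. Qed.

Lemma lookup_valid i j r : lookup tab i j = Some r -> mul (e i) (e j) = vev r.
Proof. by move=> E; have /= <- := tabP (find_entry_in E); rewrite minmax_mul. Qed.

Lemma mul_sym_valid g s : vev (mul_sym tab g s) = mul (e g) (sev s).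
Proof.
case: s => [|i [|j s]] /=; first by rewrite amul0r vev_nil.
  case E: (lookup tab g i) => [r|]; first by rewrite (lookup_valid E).
  by rewrite vev_cons vev_nil addr0 pev1 scale1r /= minmax_mul.
by rewrite vev_cons vev_nil addr0 pev1 scale1r.
Qed.

Lemma ad_valid g u : vev (ad tab g u) = mul (e g) (vev u).
Proof.
elim: u => [|x u IH]; first by rewrite /ad /= !vev_nil amul0r.
rewrite /ad /= vev_add -/(ad tab g u) IH vev_scale mul_sym_valid.
by rewrite vev_cons amulDr amulZr.
Qed.

Lemma vmul_valid u w : basic u -> vev (vmul tab u w) = mul (vev u) (vev w).
Proof.
elim: u => [|[s p] u IH] /=; first by rewrite /vmul /= !vev_nil amul0l.
case/andP=> s1 /IH{}IH.
rewrite /vmul /= vev_add -/(vmul tab u w) IH vev_scale ad_valid.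
rewrite vev_cons amulDl amulZl /=.
by case: s s1 => [|i []].
Qed.

Lemma evqE l : qev R (evq l) = ev_val R l.
Proof. by case: l; rewrite /qev /= ?divr1 ?mul0r ?mul1r ?divrr ?unitfE. Qed.

Lemma is_eigen_valid g x : is_eigen tab g x ->
  eigen iota mul (e g) x.1 (vev x.2).
Proof.
case/andP=> _ /(vev_eq iota t sev); rewrite ad_valid vev_scale pevC evqE.
by [].
Qed.

End Table.

Section Form.
Variable form : V -> V -> S.
Hypothesis formDl : forall c u v w, form (c *: u + v) w = c * form u w + form v w.
Hypothesis formC : forall u v, form u v = form v u.

Lemma form0l w : form 0 w = 0.
Proof.
have := formDl 1 0 0 w; rewrite scale1r addr0 mul1r => /esym/eqP.
by rewrite -subr_eq0 addrK => /eqP.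
Qed.

Definition gram_valid (gt : gram) : Prop :=
  forall x, List.In x gt -> form (e x.1.1) (e x.1.2) = pev x.2.

Lemma glookup_valid gt i j p : gram_valid gt ->
  lookup gt i j = Some p -> form (e i) (e j) = pev p.
Proof.
move=> gtP E; have /= <- := gtP _ (find_entry_in E).
by case: (leqP i j) => // _; rewrite formC.
Qed.

Lemma osum_valid l c : osum l = Some c ->
  pev c = \sum_(o <- l) pev (odflt [::] o) /\ all isSome l.
Proof.
elim: l c => [|[a|] l IH] c //=; first by case=> <-; rewrite big_nil.
case E: (osum l) => [b|] //= [<-]; rewrite big_cons pev_add.
by have [-> ->] := IH _ E.
Qed.

Lemma gform_valid gt u w c : gram_valid gt ->
  gform gt u w = Some c -> form (vev u) (vev w) = pev c.
Proof.
move=> gtP; rewrite /gform; case: ifP => // /andP[bu bw].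
case/osum_valid => -> /allP ok.
rewrite big_allpairs_dep /=.
have form_suml (r : vec) z :
    form (vev r) z = \sum_(x <- r) pev x.2 * form (sev x.1) z.
  elim: r => [|x r IH]; first by rewrite vev_nil big_nil form0l.
  by rewrite vev_cons big_cons formDl IH.
rewrite form_suml !big_seq; apply: eq_bigr => x xu.
rewrite formC form_suml mulr_sumr !big_seq; apply: eq_bigr => y yw.
have := ok _ (allpairs_f_dep (fun x y => omap (pmul (pmul x.2 y.2))
  (lookup gt (head 0%N x.1) (head 0%N y.1))) xu yw).
case E: (lookup gt _ _) => [b|]; last by [].
move=> _ /=.
move: (allP bu _ xu) (allP bw _ yw) E.
case: x y {xu yw} => [[|i [|? ?]] p] [[|j [|? ?]] q] //= _ _ E.
by rewrite !pev_mul formC (glookup_valid gtP E) mulrA.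
Qed.

Hypothesis formA : forall u v w, form u (mul v w) = form (mul u v) w.

Variables (tab : table) (gt : gram).
Hypotheses (tabP : table_valid tab) (gtP : gram_valid gt).

Definition axis_fusion (a : V) : Prop :=
  [/\ forall u v, eigen iota mul a Ev0 u -> eigen iota mul a Ev0 v ->
        mul a (mul u v) = 0,
      forall u v, eigen iota mul a Ev0 u -> eigen iota mul a Ev4 v ->
        mul a (mul u v) = iota 4^-1 *: mul u v
    & forall u v, eigen iota mul a Ev4 u -> eigen iota mul a Ev4 v ->
        mul a (mul u v) = (iota 4^-1 * form u v) *: a].

Hypothesis axes_fusion : forall g, (g < 6)%N -> axis_fusion (e g).

Lemma qev14 : qev R (1 # 4)%qq = 4^-1.
Proof. exact: (evqE Ev4). Qed.

Lemma fusion_rel_valid g x y : (g < 6)%N ->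
  forall r, List.In r (fusion_rel tab gt g x y) -> vev r = 0.
Proof.
move=> /axes_fusion[f00 f04 f44] r; rewrite /fusion_rel; case: ifP => //.
case/andP=> ex ey; have bx : basic x.2 by case/andP: ex.
move: ex ey => /(is_eigen_valid tabP) + /(is_eigen_valid tabP).
case: x y bx => [[] u] [[] w] //= bx ex ey; rewrite ?in_nil //.
- by case=> // <-; rewrite ad_valid // vmul_valid // f00.
- case=> // <-; rewrite vev_sub vev_scale pevC qev14 ad_valid // vmul_valid //.
  by rewrite f04 // subrr.
- case=> // <-; rewrite vev_sub vev_scale pevC qev14 ad_valid // vmul_valid //.
  by rewrite (amulC (vev u)) f04 // subrr.
- case E: (gform gt u w) => [c|] //= [] // <-.
  rewrite vev_sub vev_scale pev_scale qev14 ad_valid // vmul_valid // vev_bas.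
  by rewrite f44 // (gform_valid gtP E) subrr.
Qed.

Lemma fusion_rels_valid eigs r :
  List.In r (fusion_rels eigs tab gt) -> vev r = 0.
Proof.
move: r; apply: in_flat_map => g /in_iota g6.
apply: in_flat_map => x _; exact: fusion_rel_valid.
Qed.

Definition pivots_valid (pivs : seq (sym * vec)) : Prop :=
  forall x, List.In x pivs -> vev x.2 = 0.

Lemma reduce1_valid kq r : vev kq.2 = 0 -> vev (reduce1 kq r) = vev r.
Proof.
rewrite /reduce1 => H; case: ifP => // _.
by rewrite vev_sub vev_scale H scaler0 subr0.
Qed.

Lemma elim1_valid ok pivs r : pivots_valid pivs -> vev r = 0 ->
  pivots_valid (elim1 ok pivs r).
Proof.
rewrite /elim1 => pP r0; set r' := foldl _ _ _.
have {r0} r'0 : vev r' = 0.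
  rewrite /r'; elim: pivs r r0 pP {r'} => //= x s IH r r0 pP.
  apply: IH; last by move=> y ys; apply: pP; right.
  by rewrite reduce1_valid //; apply: pP; left.
case: pick_pivot => // k x [<-|] /=; first by rewrite vev_scale r'0 scaler0.
by move: x; apply: in_map_ind => y /pP y0; rewrite reduce1_valid //= vev_scale
  r'0 scaler0.
Qed.

Lemma eliminate_valid ok rows :
  (forall r, List.In r rows -> vev r = 0) -> pivots_valid (eliminate ok rows).
Proof.
rewrite /eliminate; have : pivots_valid [::] by [].
elim: rows [::] => //= r rows IH pivs pP H.
apply: IH; last by move=> y ys; apply: H; right.
by apply: elim1_valid => //; apply: H; left.
Qed.

Lemma learn_valid x : vev x.2 = 0 -> table_valid (learn x).
Proof.
have nilP : table_valid [::] by [].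
case: x => [[|i [|j [|? ?]]] q] //= q0; rewrite /learn /=.
case: ifP => // /andP[_].
move=> /(vev_eq iota t sev)/eqP; rewrite vev_sub q0 subr_eq0 vev_cons vev_nil.
by rewrite addr0 pev1 scale1r => /eqP /= H y [<-|].
Qed.

Lemma step_valid eigs : table_valid (step eigs gt tab).
Proof.
move=> x /List.in_app_iff[]; last exact: tabP.
move: x; apply: in_flat_map => y yP; apply: learn_valid; move: y yP.
exact: eliminate_valid (@fusion_rels_valid eigs).
Qed.

Hypothesis Y_def : forall i, (i < 3)%N ->
  e (ypos i) = mul (e (apos i true)) (e (vpos i)) - t *: e (apos i true).

Lemma gram_entry_valid i j p q : (i < 3)%N ->
    mul (e p) (e q) = mul (e (apos i true)) (e (vpos i)) ->
  gram_valid (gram_entry tab gt i j p q).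
Proof.
move=> i3 pq x; rewrite /gram_entry.
case E: (gform _ _ _) => [a|] //; case E': (lookup _ _ _) => [b|] //= [] // <- /=.
have -> : form (e (minn (ypos i) j)) (e (maxn (ypos i) j)) =
    form (e (ypos i)) (e j).
  by case: (leqP (ypos i) j) => // _; rewrite formC.
rewrite Y_def // addrC -scaleNr formDl -pq -formA (glookup_valid gtP E').
move: (gform_valid gtP E); rewrite vev_bas ad_valid // vev_bas /= => ->.
by rewrite pev_add pev_mul pev_linN addrC.
Qed.

Lemma gram_step_valid : gram_valid (gram_step tab gt).
Proof.
move=> x /List.in_app_iff[]; last exact: gtP.
move: x; apply: in_flat_map => i /in_iota i3.
apply: in_flat_map => j _.
have H1 := @gram_entry_valid i j (apos i true) (vpos i) i3 erefl.
have H2 := @gram_entry_valid i j (vpos i) (apos i true) i3 (amulC _ _).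
case: lookup => //; case: gram_entry H1 => [|x l] H1 y; first exact: H2.
by case=> // <-; apply: H1; left.
Qed.

End Form.
End Algebra.

Lemma ord3_ind (P : 'I_3 -> Prop) : P i1 -> P i2 -> P i3 -> forall i, P i.
Proof.
move=> P1 P2 P3 [[|[|[|//]]] Hi].
- by rewrite (_ : Ordinal Hi = i1) //; apply: val_inj.
- by rewrite (_ : Ordinal Hi = i2) //; apply: val_inj.
- by rewrite (_ : Ordinal Hi = i3) //; apply: val_inj.
Qed.

Lemma exists_other (i : 'I_3) : exists j, i != j.
Proof. by elim/ord3_ind: i; [exists i2|exists i1|exists i1]. Qed.

Lemma vv_arith (S : comNzRingType) (X F K t : S) :
    K + (K + K) + (t + (t + t)) + K + t - X *+ 3 =
    4 * (F + (F + (F + (F + F))) - F - F *+ 2 - F *+ 2 + (t + (t + t))) ->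
  X *+ 3 = K *+ 4 - t *+ 8.
Proof.
move=> E; transitivity (K + (K + K) + (t + (t + t)) + K + t -
  (K + (K + K) + (t + (t + t)) + K + t - X *+ 3)); first by ring.
by rewrite E; ring.
Qed.

Lemma iter_ind (T : Type) (P : T -> Prop) (f : T -> T) n x :
  P x -> (forall y, P y -> P (f y)) -> P (iter n f x).
Proof. by move=> Px Pf; elim: n => //= n; apply: Pf. Qed.

Section Constants.
Variables (R : realType) (S : comNzRingType) (iota : {rmorphism R -> S}).
Variables (t : S) (V : lmodType S) (val : sym -> V).

Lemma qevN p d : qev R (Zneg p # d) = - qev R (Zpos p # d).
Proof.
rewrite /qev /= NegzE prednK ?mulrNz ?mulNr //.
exact/ltP/Pos2Nat.is_pos.
Qed.

Lemma vev_cst q n u : vev iota t val (cst q n :: u) =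
  iota (qev R q) *: val [:: n] + vev iota t val u.
Proof. by rewrite vev_cons pevC. Qed.

Lemma vev_axax a b a' b' v : vev iota t val (axax_vec a b a' b' v) =
  iota 64^-1 *: (val [:: a] *+ 3 + val [:: b] *+ 3 + val [:: a'] + val [:: b']
                 - val [:: v] *+ 3).
Proof.
rewrite !vev_cst vev_nil qevN (_ : qev R (3 # 64) = 3%:R / 64%:R) //.
rewrite (_ : qev R (1 # 64) = 1 / 64%:R) // mulr_natl mul1r.
rewrite rmorphN rmorphMn scaleNr !scalerDr scalerN -!scalerMnl -!scalerMnr.
by rewrite addr0 !mulrS !mulr0n !addr0 !addrA.
Qed.

Lemma vev_axv a a' b b' v : vev iota t val (axv_vec a a' b b' v) =
  iota 16^-1 *: (val [:: a] *+ 5 - val [:: a'] - val [:: b] *+ 2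
                 - val [:: b'] *+ 2 + val [:: v] *+ 3).
Proof.
rewrite !vev_cst vev_nil !qevN (_ : qev R (3 # 16) = 3%:R / 16%:R) //.
rewrite (_ : qev R (5 # 16) = 5%:R / 16%:R) //.
rewrite (_ : qev R (1 # 16) = 1 / 16%:R) //.
have -> : qev R (1 # 8) = 2%:R / 16%:R.
  by rewrite (_ : qev R _ = 1 / 8%:R) //; field.
rewrite !mulr_natl !mul1r !rmorphN !rmorphMn !scaleNr !scalerDr !scalerN.
rewrite -!scalerMnl -!scalerMnr.
by rewrite addr0 !mulrS !mulr0n !addr0 !addrA.
Qed.

End Constants.

Section FrobeniusAxes.
Variables (R : realType) (S : comNzRingType) (iota : {rmorphism R -> S}).
Variables (V : lmodType S) (mul : V -> V -> V).
Variables (ax : gen -> V) (form : V -> V -> S).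
Hypothesis PF : primitive_frobenius_axial iota mul ax form.

Let mulP : comm_algebra mul. Proof. by case: PF => -[]. Qed.

Lemma formDl c u v w : form (c *: u + v) w = c * form u w + form v w.
Proof. by case: PF => _ _ []. Qed.
Lemma formDr c u v w : form w (c *: u + v) = c * form w u + form w v.
Proof. by case: PF => _ _ []. Qed.
Lemma formA u v w : form u (mul v w) = form (mul u v) w.
Proof. by case: PF => _ _ []. Qed.
Lemma form_ax g : form (ax g) (ax g) = 1.
Proof. by case: PF. Qed.

Lemma ax_idem g : mul (ax g) (ax g) = ax g.
Proof. by case: PF => -[_ /(_ g)[]]. Qed.

Lemma fm0l w : form 0 w = 0.
Proof. exact: form0l formDl w. Qed.
Lemma fm0r w : form w 0 = 0.
Proof.
have := formDr 1 0 0 w; rewrite scale1r addr0 mul1r => /esym/eqP.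
by rewrite -subr_eq0 addrK => /eqP.
Qed.
Lemma fmZl c u w : form (c *: u) w = c * form u w.
Proof. by rewrite -[c *: u]addr0 formDl fm0l addr0. Qed.
Lemma fmZr c u w : form w (c *: u) = c * form w u.
Proof. by rewrite -[c *: u]addr0 formDr fm0r addr0. Qed.
Lemma fmDl u v w : form (u + v) w = form u w + form v w.
Proof. by rewrite -[u]scale1r formDl mul1r scale1r. Qed.
Lemma fmDr u v w : form w (u + v) = form w u + form w v.
Proof. by rewrite -[u]scale1r formDr mul1r scale1r. Qed.

Lemma iota_inj (c : R) (x y : S) : c != 0 -> iota c * x = iota c * y -> x = y.
Proof.
move=> c0 /(congr1 ( *%R (iota c^-1))).
by rewrite !mulrA -rmorphM mulVf // rmorph1 !mul1r.
Qed.

Lemma ev_neq1 l : l <> Ev1 -> 1 - ev_val R l != 0.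
Proof.
case: l => // _; rewrite /ev_val ?subr0 ?oner_eq0 // subr_eq0 eq_sym.
  by rewrite -{2}invr1 (inj_eq invr_inj) pnatr_eq1.
by rewrite -{2}invr1 (inj_eq invr_inj) pnatr_eq1.
Qed.

Lemma scaled_eq0 l (x : S) : l <> Ev1 -> x = iota (ev_val R l) * x -> x = 0.
Proof.
move/ev_neq1 => l1 E; apply: (iota_inj l1).
by rewrite mulr0 rmorphB rmorph1 mulrBl mul1r -E subrr.
Qed.

Lemma form_ax_eigen_r g l u : l <> Ev1 -> eigen iota mul (ax g) l u ->
  form (ax g) u = 0.
Proof.
move=> l1 E; apply: (scaled_eq0 l1).
by rewrite -{1}[ax g]ax_idem -formA E fmZr.
Qed.

Lemma form_ax_eigen_l g l u : l <> Ev1 -> eigen iota mul (ax g) l u ->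
  form u (ax g) = 0.
Proof.
move=> l1 E; apply: (scaled_eq0 l1).
by rewrite -{1}[ax g]ax_idem formA (amulC mulP) E fmZl.
Qed.

Lemma formC u v : form u v = form v u.
Proof.
suff H : forall w, form u w = form w u by [].
have gen : generated mul (fun x => exists g, x = ax g) u by case: PF => -[].
apply: (gen (fun u => forall w, form u w = form w u)) => {u v gen}.
  split=> [w|u v Pu Pv w|c u Pu w|u v Pu Pv w].
  - by rewrite fm0l fm0r.
  - by rewrite fmDl fmDr Pu Pv.
  - by rewrite fmZl fmZr Pu.
  - by rewrite -formA Pu -formA Pv formA.
move=> _ [g ->] w.
have [f [fE ->]] : eigen_sum iota mul (ax g) monster_all w.
  by case: PF => -[_ /(_ g)[]].
have [c fc] : exists c, f Ev1 = c *: ax g.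
  by case: PF => _ /(_ g)/(_ (f Ev1))[H _] _ _; apply: H.
rewrite /monster_all !big_cons big_nil addr0 fc !fmDl !fmDr.
rewrite !(form_ax_eigen_r _ (fE _)) // !(form_ax_eigen_l _ (fE _)) //.
by rewrite fmZl fmZr.
Qed.

Lemma ax_fusion g : axis_fusion iota mul form (ax g).
Proof.
have Fus : forall l m u v, eigen iota mul (ax g) l u ->
    eigen iota mul (ax g) m v ->
    eigen_sum iota mul (ax g) (fusion l m) (mul u v).
  by case: PF => -[_ /(_ g)[]].
split=> u v Eu Ev; have [f [fE fS]] := Fus _ _ _ _ Eu Ev;
  move: fS; rewrite !big_cons big_nil ?addr0 => uvE.
- by rewrite uvE fE /= rmorph0 scale0r.
- by rewrite uvE fE.
have [c fc] : exists c, f Ev1 = c *: ax g.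
  by case: PF => _ /(_ g)/(_ (f Ev1))[H _] _ _; apply: H.
have -> : iota 4^-1 * form u v = c.
  rewrite -fmZl -Eu -formA uvE fmDr (form_ax_eigen_r _ (fE Ev0)) // fc.
  by rewrite fmZr form_ax mulr1 addr0.
by rewrite uvE (amulDr mulP) !fE /= rmorph1 rmorph0 scale0r scale1r addr0.
Qed.

Variable vs : 'I_3 -> 'I_3 -> V.
Hypothesis vsC : forall i j, vs i j = vs j i.
Hypothesis vsP : forall i j, i != j -> type4A iota mul ax form i j (vs i j).

Lemma ax_mul i j d s : i != j -> mul (ax (i, d)) (ax (j, s)) = iota 64^-1 *:
  (ax (i, d) *+ 3 + ax (j, s) *+ 3 + ax (i, ~~ d) + ax (j, ~~ s) - vs i j *+ 3).
Proof. by case/vsP=> _ _ [-> _]. Qed.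

Lemma ax_mul_v i j d : i != j -> mul (ax (i, d)) (vs i j) = iota 16^-1 *:
  (ax (i, d) *+ 5 - ax (i, ~~ d) - ax (j, true) *+ 2 - ax (j, false) *+ 2
   + vs i j *+ 3).
Proof. by case/vsP=> _ _ [_ [-> _]]. Qed.

Lemma v_idem i j : i != j -> mul (vs i j) (vs i j) = vs i j.
Proof. by case/vsP. Qed.

Lemma ax_mul_opp i : mul (ax (i, true)) (ax (i, false)) = 0.
Proof. by have [j /vsP[_ _ _ []]] := exists_other i. Qed.

Lemma form_opp i : form (ax (i, true)) (ax (i, false)) = 0.
Proof. by have [j /vsP[_ _ _ _ [_ []]]] := exists_other i. Qed.

Lemma form_ax_ax i j d s : i != j -> form (ax (i, d)) (ax (j, s)) = iota 32^-1.
Proof. by case/vsP=> _ _ _ _ []. Qed.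

Lemma form_ax_v i j d : i != j -> form (ax (i, d)) (vs i j) = iota (3 / 8).
Proof. by case/vsP=> _ _ _ _ []. Qed.

Lemma form_v_v i j : i != j -> form (vs i j) (vs i j) = 2.
Proof. by case/vsP=> _ _ _ _ []. Qed.

Lemma fmNr u w : form w (- u) = - form w u.
Proof. by rewrite -scaleN1r fmZr mulN1r. Qed.
Lemma fmMnr u w n : form w (u *+ n) = form w u *+ n.
Proof. by rewrite -scaler_nat fmZr mulr_natl. Qed.

Lemma mul3_inj (x y : S) : x *+ 3 = y *+ 3 -> x = y.
Proof.
move=> E; apply: (@iota_inj 3%:R); first by rewrite pnatr_eq0.
by rewrite rmorph_nat !mulr_natl.
Qed.

(* Evaluating <a_i, a_j a_k> = <a_i a_j, a_k>. *)
Lemma form_ax_v_swap i j k d s : i != j -> j != k -> i != k ->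
  form (ax (i, d)) (vs j k) = form (ax (k, s)) (vs i j).
Proof.
move=> ij jk ik.
have := formA (ax (i, d)) (ax (j, true)) (ax (k, s)).
rewrite (formC (mul _ _)) !ax_mul // !fmZr.
have h : (64^-1 : R) != 0 by rewrite invr_eq0 pnatr_eq0.
move/(iota_inj h); rewrite !fmDr !fmNr !fmMnr !form_ax_ax // 1?eq_sym //.
by move=> /addrI/oppr_inj/mul3_inj.
Qed.

Let t := form (ax (i1, true)) (vs i2 i3).

Lemma form_ax_vt i j k d : i != j -> j != k -> i != k ->
  form (ax (i, d)) (vs j k) = t.
Proof.
have sw (a b c : 'I_3) x y := @form_ax_v_swap a b c x y.
have T1 : form (ax (i1, false)) (vs i2 i3) = t.
  by rewrite (sw i1 i2 i3 false true) // vsC (sw i3 i2 i1 true true) // vsC.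
have {}T1 x : form (ax (i1, x)) (vs i2 i3) = t by case: x.
have T2 x : form (ax (i2, x)) (vs i1 i3) = t.
  by rewrite vsC (sw i2 i3 i1 x true) // T1.
have T3 x : form (ax (i3, x)) (vs i1 i2) = t.
  by rewrite vsC (sw i3 i2 i1 x true) // vsC T1.
elim/ord3_ind: i; elim/ord3_ind: j; elim/ord3_ind: k => //= _ _ _;
  by rewrite ?T1 ?T2 ?T3 // vsC ?T1 ?T2 ?T3.
Qed.

(* Evaluating <v_ij, a_i a_k> = <v_ij a_i, a_k>. *)
Lemma form_v_v' i j k : i != j -> j != k -> i != k ->
  form (vs i j) (vs i k) = iota (1 / 2) - iota (8 / 3) * t.
Proof.
move=> ij jk ik.
have := formA (vs i j) (ax (i, true)) (ax (k, true)).
rewrite (amulC mulP (vs i j)) (formC (mul _ _)) ax_mul // ax_mul_v // !fmZr.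
rewrite !fmDr !fmNr !fmMnr !(formC (vs i j) (ax _)).
rewrite !form_ax_v // !(@form_ax_vt k i j) // 1?eq_sym //.
rewrite !(@form_ax_ax k) // 1?eq_sym //.
have -> : iota 16^-1 = iota 64^-1 * 4.
  by rewrite -(rmorph_nat iota) -rmorphM; congr (iota _); field.
rewrite -mulrA => /iota_inj; rewrite invr_eq0 pnatr_eq0 => /(_ isT).
move/vv_arith => E; apply: mul3_inj; rewrite E.
rewrite mulrnBl -mulrnAl -!rmorphMn.
have -> : (3 / 8) *+ 4 = (1 / 2) *+ 3 :> R by field.
have -> : (8 / 3) *+ 3 = 8%:R :> R by field.
by rewrite rmorph_nat mulr_natl.
Qed.

Definition elt (n : nat) : V :=
  nth 0 [:: ax (i1, true); ax (i1, false); ax (i2, true); ax (i2, false);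
    ax (i3, true); ax (i3, false); vs i2 i3; vs i1 i3; vs i1 i2;
    mul (ax (i1, true)) (vs i2 i3) - t *: ax (i1, true);
    mul (ax (i2, true)) (vs i1 i3) - t *: ax (i2, true);
    mul (ax (i3, true)) (vs i1 i2) - t *: ax (i3, true)] n.

Lemma eltA (i : 'I_3) s : elt (apos i s) = ax (i, s).
Proof. by elim/ord3_ind: i; case: s. Qed.

Lemma eltV (i j k : 'I_3) : i != j -> j != k -> i != k ->
  elt (vpos k) = vs i j.
Proof.
by elim/ord3_ind: i; elim/ord3_ind: j; elim/ord3_ind: k => //= _ _ _; rewrite vsC.
Qed.

Lemma eltY (i : nat) : (i < 3)%N ->
  elt (ypos i) = mul (elt (apos i true)) (elt (vpos i)) - t *: elt (apos i true).
Proof. by case: i => [|[|[|//]]]. Qed.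

Lemma others_spec (i : nat) jk : (i < 3)%N -> List.In jk (others i) ->
  exists i' j k : 'I_3,
    [/\ i = i', jk = (j : nat, k : nat), i' != j, j != k & i' != k].
Proof.
case: i => [|[|[|//]]] _ /= [<-|[<-|//]].
- by exists i1, i2, i3.
- by exists i1, i3, i2.
- by exists i2, i1, i3.
- by exists i2, i3, i1.
- by exists i3, i1, i2.
- by exists i3, i2, i1.
Qed.

Local Notation vev := (vev iota t (sev mul elt)).

Lemma axax_table (i j k : 'I_3) d s : i != j -> j != k -> i != k ->
  mul (elt (apos i d)) (elt (apos j s)) =
  vev (axax_vec (apos i d) (apos j s) (apos i (~~ d)) (apos j (~~ s)) (vpos k)).
Proof.
move=> ij jk ik; rewrite vev_axax /= !eltA (eltV ij jk ik).
exact: ax_mul.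
Qed.

Lemma axv_table (i j k : 'I_3) d : i != j -> j != k -> i != k ->
  mul (elt (apos i d)) (elt (vpos k)) = vev (axv_vec (apos i d) (apos i (~~ d))
    (apos j true) (apos j false) (vpos k)).
Proof.
move=> ij jk ik; rewrite vev_axv /= !eltA (eltV ij jk ik).
exact: ax_mul_v.
Qed.

Lemma ord3E (i : nat) : (i < 3)%N -> exists j : 'I_3, i = j.
Proof. by move=> i3; exists (Ordinal i3). Qed.

Lemma table0_valid : table_valid iota t mul elt table0.
Proof.
have entryP i j r : mul (elt i) (elt j) = vev r ->
    forall y, List.In y (entry i j r) -> mul (elt y.1.1) (elt y.1.2) = vev y.2.
  by move=> E y [<-|] //=; rewrite minmax_mul.
apply: in_cat_ind; [|apply: in_cat_ind; [|apply: in_cat_ind; [|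
  apply: in_cat_ind; [|apply: in_cat_ind]]]].
- apply: in_flat_map => i /in_iota/ord3E[j ->]; apply: in_flat_map => d _.
  by apply: entryP; rewrite vev_bas /= eltA ax_idem.
- apply: in_flat_map => i /in_iota/ord3E[j ->].
  by apply: entryP; rewrite vev_nil !eltA ax_mul_opp.
- apply: in_flat_map => i /in_iota i3; apply: in_flat_map => jk.
  case/(others_spec i3)=> i' [j [k [-> -> ij jk' ik]]].
  apply: in_flat_map => d _; apply: in_flat_map => s _.
  exact/entryP/axax_table.
- apply: in_flat_map => i /in_iota i3; apply: in_flat_map => jk.
  case/(others_spec i3)=> i' [j [k [-> -> ij jk' ik]]].
  apply: in_flat_map => d _; exact/entryP/axv_table.
- apply: in_flat_map => i /in_iota/ord3E[k ->]; apply: entryP.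
  have [i' [j [ij [jk ik]]]] : exists i' j : 'I_3, i' != j /\ j != k /\ i' != k.
    by elim/ord3_ind: k; [exists i2, i3|exists i1, i3|exists i1, i2].
  by rewrite vev_bas /= (eltV ij jk ik) v_idem.
- apply: in_flat_map => i /in_iota i3; apply: entryP.
  rewrite vev_cst vev_cons vev_nil addr0 pev_lin qev1 rmorph1 mulr1 scale1r /=.
  by rewrite eltY // subrK.
Qed.

Lemma gram0_valid : gram_valid iota t elt form gram0.
Proof.
have entryP i j p : form (elt i) (elt j) = pev iota t p ->
    forall y, List.In y (entry i j p) ->
    form (elt y.1.1) (elt y.1.2) = pev iota t y.2.
  by move=> E y [<-|] //=; case: (leqP i j) => // _; rewrite formC.
have opp (k : 'I_3) : exists i' j : 'I_3, [/\ i' != j, j != k & i' != k].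
  by elim/ord3_ind: k; [exists i2, i3|exists i1, i3|exists i1, i2].
(apply: in_cat_ind; [|apply: in_cat_ind; [|apply: in_cat_ind; [|
  apply: in_cat_ind; [|apply: in_cat_ind; [|apply: in_cat_ind]]]]]);
  apply: in_flat_map => i /in_iota i3.
- apply: in_flat_map => d _; have [j ->] := ord3E i3.
  by apply: entryP; rewrite eltA form_ax pev1.
- by have [j ->] := ord3E i3; apply: entryP; rewrite !eltA form_opp.
- apply: in_flat_map => jk.
  case/(others_spec i3)=> i' [j [k [-> -> ij jk' ik]]].
  apply: in_flat_map => d _; apply: in_flat_map => s _.
  apply: entryP; rewrite !eltA form_ax_ax // pevC.
  by rewrite (_ : qev R _ = 1 / 32%:R) // mul1r.
- apply: in_flat_map => jk.
  case/(others_spec i3)=> i' [j [k [-> -> ij jk' ik]]].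
  apply: in_flat_map => d _; apply: entryP.
  by rewrite eltA (eltV ij jk' ik) form_ax_v // pevC.
- have [k ->] := ord3E i3; apply: in_flat_map => d _; apply: entryP.
  have [i' [j [ij jk ik]]] := opp k.
  have [ki kj] : k != i' /\ k != j by rewrite !(eq_sym k).
  by rewrite eltA (eltV ij jk ik) form_ax_vt // pev_lin qev1 rmorph1 mulr1.
- have [k ->] := ord3E i3; apply: entryP.
  have [i' [j [ij jk ik]]] := opp k.
  rewrite (eltV ij jk ik) form_v_v // pevC.
  by rewrite (_ : qev R _ = 2%:R / 1) // divr1 rmorph_nat.
- apply: in_flat_map => jk.
  case/(others_spec i3)=> i' [j [k [_ -> ij jk' ik]]]; apply: entryP.
  have kj : k != j by rewrite eq_sym.
  rewrite (eltV ik kj ij) (eltV ij jk' ik) form_v_v' //.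
  rewrite /= mulr0 addr0 qevN rmorphN mulrN [t * _]mulrC.
  by rewrite (_ : qev R (1 # 2) = 1 / 2%:R) // (_ : qev R (8 # 3) = 8%:R / 3%:R).
Qed.

Lemma elt_fusion g : (g < 6)%N -> axis_fusion iota mul form (elt g).
Proof.
move=> g6; have -> : g = apos g./2 (~~ odd g).
  by rewrite /apos negbK addnC odd_double_half.
have [i ->] : exists i : 'I_3, g./2 = i by apply: ord3E; rewrite ltn_half_double.
by rewrite eltA; apply: ax_fusion.
Qed.

Opaque step gram_step.

Lemma full_gram_table_valid :
  gram_valid iota t elt form full_gram /\ table_valid iota t mul elt full_table.
Proof.
have tstep eigs gt tab : gram_valid iota t elt form gt ->
    table_valid iota t mul elt tab ->
    table_valid iota t mul elt (step eigs gt tab).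
  move=> gP tP; exact: (step_valid mulP formDl formC tP gP elt_fusion).
have gstep tab gt : table_valid iota t mul elt tab ->
    gram_valid iota t elt form gt ->
    gram_valid iota t elt form (gram_step tab gt).
  move=> tP gP; exact: (gram_step_valid mulP formDl formC formA tP gP eltY).
have t4A : table_valid iota t mul elt table_4A.
  rewrite /table_4A.
  refine (@iter_ind _ (table_valid iota t mul elt) (step eigs_4A gram0) 2%N
    table0 table0_valid _).
  by move=> tab; exact: (tstep _ _ _ gram0_valid).
have gf : gram_valid iota t elt form full_gram_def.
  rewrite /full_gram_def.
  refine (@iter_ind _ (gram_valid iota t elt form) (gram_step table_4A) 3%N
    gram0 gram0_valid _).
  by move=> gt; exact: (gstep _ _ t4A).
rewrite -full_gramE -full_tableE; split; first exact: gf.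
rewrite /full_table_def.
refine (@iter_ind _ (table_valid iota t mul elt) (step eigs_full full_gram_def)
  2%N table_4A t4A _).
by move=> tab; exact: (tstep _ _ _ gf).
Qed.

End FrobeniusAxes.

(** * Eigenspaces of an axis *)

Definition ev_eqb (l m : monster_ev) : bool :=
  match l, m with
  | Ev1, Ev1 | Ev0, Ev0 | Ev4, Ev4 | Ev32, Ev32 => true
  | _, _ => false
  end.

Lemma ev_eqP l m : reflect (l = m) (ev_eqb l m).
Proof. by case: l; case: m; constructor. Qed.

Lemma ev_val_inj (R : realType) l m : l <> m -> ev_val R l - ev_val R m != 0.
Proof.
have h4 : (4 : R) != 0 by rewrite pnatr_eq0.
have h32 : (32 : R) != 0 by rewrite pnatr_eq0.
have E (a b : R) : 32 * a != 32 * b -> a - b != 0.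
  by move=> H; rewrite subr_eq0; apply: contraNneq H => ->.
have v4 : 32 * ev_val R Ev4 = 8%:R by rewrite /=; field.
have v32 : 32 * ev_val R Ev32 = 1%:R by rewrite /=; field.
have v1 : 32 * ev_val R Ev1 = 32%:R by rewrite /= mulr1.
have v0 : 32 * ev_val R Ev0 = 0%:R by rewrite /= mulr0.
by case: l; case: m => // _; apply: E; rewrite ?v1 ?v0 ?v4 ?v32 eqr_nat.
Qed.

Section Eigen.
Variables (R : realType) (S : comNzRingType) (iota : {rmorphism R -> S}).
Variables (V : lmodType S) (mul : V -> V -> V).
Hypothesis mulP : comm_algebra mul.
Variable a : V.

Local Arguments ev_val : simpl never.

Local Notation eigen := (eigen iota mul a).
Local Notation eigen_sum := (eigen_sum iota mul a).

Definition ad_sub (x : V) (l : monster_ev) : V :=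
  mul a x - iota (ev_val R l) *: x.

Lemma ad_sub_lin l c u v : ad_sub (c *: u + v) l = c *: ad_sub u l + ad_sub v l.
Proof.
rewrite /ad_sub (amulDr mulP) (amulZr mulP) !scalerDr scalerN.
by rewrite !scalerA [c * _]mulrC opprD addrACA.
Qed.

Lemma ad_sub_eigen l m u : eigen m u ->
  ad_sub u l = iota (ev_val R m - ev_val R l) *: u.
Proof. by rewrite /ad_sub => ->; rewrite rmorphB scalerBl. Qed.

Lemma iota_scale_inj (c : R) (x : V) : c != 0 -> iota c *: x = 0 -> x = 0.
Proof.
move=> c0 /(congr1 ( *:%R (iota c^-1))).
by rewrite scalerA -rmorphM mulVf // rmorph1 scale1r scaler0.
Qed.

Lemma eigen0 l : eigen l 0.
Proof. by rewrite /Defs.eigen (amul0r mulP) scaler0. Qed.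

Lemma eigen_lin l c u v : eigen l u -> eigen l v -> eigen l (c *: u + v).
Proof.
rewrite /Defs.eigen (amulDr mulP) (amulZr mulP) => -> ->.
by rewrite scalerDr !scalerA mulrC.
Qed.

Lemma ad_subs_lin L c u v :
  foldl ad_sub (c *: u + v) L = c *: foldl ad_sub u L + foldl ad_sub v L.
Proof. by elim: L u v => //= l L IH u v; rewrite ad_sub_lin IH. Qed.

Lemma ad_subs0 L : foldl ad_sub 0 L = 0.
Proof.
have ad0 l : ad_sub 0 l = 0 by rewrite /ad_sub (amul0r mulP) scaler0 subrr.
by elim: L => //= l L; rewrite ad0.
Qed.

Lemma ad_subs_eigen L m u : eigen m u ->
  foldl ad_sub u L = iota (\prod_(l <- L) (ev_val R m - ev_val R l)) *: u.
Proof.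
elim: L u => [|l L IH] u Eu /=; first by rewrite big_nil rmorph1 scale1r.
rewrite (ad_sub_eigen l Eu) -[_ *: u]addr0 ad_subs_lin ad_subs0 addr0 IH //.
by rewrite big_cons rmorphM scalerA.
Qed.

Lemma eigen_indep (f : monster_ev -> V) : (forall l, eigen l (f l)) ->
  \sum_(l <- monster_all) f l = 0 -> forall l, f l = 0.
Proof.
move=> fE S0 m.
pose L := [seq l <- monster_all | ~~ ev_eqb m l].
have H l : foldl ad_sub (f l) L = if ev_eqb m l then
    iota (\prod_(k <- L) (ev_val R m - ev_val R k)) *: f m else 0.
  rewrite (ad_subs_eigen _ (fE l)); case: ev_eqP => [<-//|ml].
  rewrite (_ : \prod_(k <- L) _ = 0) ?rmorph0 ?scale0r // /L.
  by case: m l {L S0} ml => [] [] // _; rewrite !big_cons subrr ?mul0r ?mulr0.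
have nz : \prod_(k <- L) (ev_val R m - ev_val R k) != 0.
  by rewrite /L; case: m {H L} => /=; rewrite !big_cons big_nil;
    rewrite !mulf_neq0 ?oner_eq0 // ev_val_inj.
apply: (iota_scale_inj nz); move: S0 => /(congr1 (fun x => foldl ad_sub x L)).
rewrite ad_subs0 !big_cons big_nil -[f Ev1]scale1r -[f Ev0]scale1r.
rewrite -[f Ev4]scale1r -[f Ev32]scale1r !ad_subs_lin ad_subs0 !H.
by case: (m) => /=; rewrite !scaler0 ?scale1r ?add0r ?addr0.
Qed.

Lemma eigen_sum_lin L c u v : eigen_sum L u -> eigen_sum L v ->
  eigen_sum L (c *: u + v).
Proof.
move=> [f [fE ->]] [g [gE ->]]; exists (fun l => c *: f l + g l); split.
  by move=> l; apply: eigen_lin.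
by rewrite big_split scaler_sumr.
Qed.

Lemma eigen_sum0 L : eigen_sum L 0.
Proof. by exists (fun=> 0); split=> [l|]; [apply: eigen0|rewrite big1]. Qed.

Lemma eigen_sum_annihilated L v : pairwise (fun l m => ~~ ev_eqb l m) L ->
  foldl ad_sub v L = 0 -> eigen_sum L v.
Proof.
elim: L v => [|l L IH] v /= => [_ ->|/andP[lL uL] /(IH _ uL) [w [wE vE]]].
  exact: eigen_sum0.
pose c m : R := (ev_val R m - ev_val R l)^-1.
pose W := \sum_(m <- L) iota (c m) *: w m.
exists (fun m => if ev_eqb l m then v - W else iota (c m) *: w m).
have sumE z (F : monster_ev -> V) :
    \sum_(m <- L) (if ev_eqb l m then z else F m) = \sum_(m <- L) F m.
  elim: L lL {IH uL vE W} => [|m L IH] /=; first by rewrite !big_nil.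
  by case/andP=> /negPf lm /IH{}IH; rewrite !big_cons lm IH.
have ll : ev_eqb l l by case: (l).
split; last by rewrite big_cons sumE ll subrK.
move=> m; case: ev_eqP => [<-|lm]; last first.
  by rewrite -[_ *: _]addr0; apply: eigen_lin => //; apply: eigen0.
apply/eqP; rewrite -subr_eq0; apply/eqP; rewrite -/(ad_sub (v - W) l).
rewrite addrC -scaleN1r ad_sub_lin scaleN1r vE /W.
suff -> : ad_sub (\sum_(m <- L) iota (c m) *: w m) l = \sum_(l <- L) w l.
  by rewrite addNr.
elim: L lL {IH uL vE W sumE} => [|k L IH] /=.
  by rewrite !big_nil; have := ad_subs0 [:: l].
case/andP=> /ev_eqP lk /IH{}IH; rewrite !big_cons ad_sub_lin IH.
rewrite (ad_sub_eigen l (wE k)) scalerA -rmorphM /c mulVf ?rmorph1 ?scale1r //.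
exact/ev_val_inj/nesym.
Qed.

End Eigen.

Lemma all_In (T : Type) (p : T -> bool) s x : all p s -> List.In x s -> p x.
Proof. by elim: s => //= y s IH /andP[py /IH{}IH] [<-|/IH]. Qed.

Lemma all_iotaP (p : nat -> bool) n i : all p (iota 0 n) -> (i < n)%N -> p i.
Proof. by move=> /allP H i_n; apply: H; rewrite mem_iota. Qed.

Definition tprod (i j : nat) : vec := odflt [::] (lookup full_table i j).
Definition tform (i j : nat) : pol := odflt [::] (lookup full_gram i j).

Opaque full_table full_gram.
Arguments tprod : simpl never.
Arguments tform : simpl never.

Lemma lookupC (T : Type) (l : assoc_list T) i j : lookup l i j = lookup l j i.
Proof. by rewrite /lookup minnC maxnC. Qed.

(** * The 12-dimensional algebra over an arbitrary coefficient ring *)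
Section Model.
Variables (R : realType) (S : comNzRingType) (iota : {rmorphism R -> S}).
Variable t : S.

Local Notation V := 'rV[S]_12.

Definition bvec (n : nat) : V := \row_(j < 12) ((j : nat) == n)%:R.

Definition lin (u : vec) : V := vev iota t (fun s => bvec (head 0%N s)) u.

Definition mulM (u v : V) : V :=
  \sum_(i < 12) \sum_(j < 12) (u 0 i * v 0 j) *: lin (tprod i j).

Definition formM (u v : V) : S :=
  \sum_(i < 12) \sum_(j < 12) u 0 i * v 0 j * pev iota t (tform i j).

Definition axM (g : gen) : V := bvec (apos g.1 g.2).

Lemma row_bvec (v : V) : v = \sum_(i < 12) v 0 i *: bvec i.
Proof.
apply/rowP => j; rewrite summxE (bigD1 j) //= !mxE eqxx mulr1 big1 ?addr0 //.
by move=> i ij; rewrite !mxE val_eqE eq_sym (negPf ij) mulr0.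
Qed.

Lemma bvec_ind (P : V -> Prop) : P 0 ->
  (forall c u v, P u -> P v -> P (c *: u + v)) ->
  (forall n, (n < 12)%N -> P (bvec n)) -> forall v, P v.
Proof.
move=> P0 PD Pb v; rewrite (row_bvec v).
elim/big_ind: _ => [//|u w Pu Pw|i _]; first by rewrite -[u]scale1r; apply: PD.
by rewrite -[_ *: _]addr0; apply: PD => //; apply: Pb.
Qed.

Lemma sum_bvec (W : lmodType S) n (n12 : (n < 12)%N) (F : 'I_12 -> W) :
  \sum_i bvec n 0 i *: F i = F (Ordinal n12).
Proof.
rewrite (bigD1 (Ordinal n12)) //= mxE eqxx scale1r big1 ?addr0 // => i ni.
by rewrite mxE (_ : (i == n :> nat) = false) ?scale0r //; apply: negbTE.
Qed.

Lemma mulM_bvec i j : (i < 12)%N -> (j < 12)%N ->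
  mulM (bvec i) (bvec j) = lin (tprod i j).
Proof.
move=> i12 j12; rewrite /mulM.
transitivity (\sum_k bvec i 0 k *: \sum_l bvec j 0 l *: lin (tprod k l)).
  apply: eq_bigr => k _; rewrite scaler_sumr.
  by apply: eq_bigr => l _; rewrite scalerA.
by rewrite (sum_bvec i12) (sum_bvec j12).
Qed.

Lemma formM_bvec i j : (i < 12)%N -> (j < 12)%N ->
  formM (bvec i) (bvec j) = pev iota t (tform i j).
Proof.
move=> i12 j12; rewrite /formM.
transitivity (\sum_k bvec i 0 k *:
    \sum_l bvec j 0 l *: (pev iota t (tform k l) : S^o)).
  apply: eq_bigr => k _; rewrite scaler_sumr.
  by apply: eq_bigr => l _; rewrite scalerA.
by rewrite (sum_bvec i12) (sum_bvec j12).
Qed.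

Lemma mulM_comm : comm_algebra mulM.
Proof.
split=> [u v|u v w|c u v].
- rewrite /mulM exchange_big; apply: eq_bigr => i _; apply: eq_bigr => j _.
  by rewrite mulrC /tprod lookupC.
- rewrite /mulM -big_split; apply: eq_bigr => i _ /=.
  by rewrite -big_split; apply: eq_bigr => j _ /=; rewrite mxE mulrDl scalerDl.
rewrite /mulM scaler_sumr; apply: eq_bigr => i _.
by rewrite scaler_sumr; apply: eq_bigr => j _; rewrite mxE scalerA mulrA.
Qed.

Lemma formM_sym u v : formM u v = formM v u.
Proof.
rewrite /formM exchange_big; apply: eq_bigr => i _; apply: eq_bigr => j _.
by rewrite [u 0 _ * _]mulrC /tform lookupC.
Qed.

Lemma formM_linl c u v w : formM (c *: u + v) w = c * formM u w + formM v w.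
Proof.
rewrite /formM mulr_sumr -big_split; apply: eq_bigr => i _ /=.
rewrite mulr_sumr -big_split; apply: eq_bigr => j _ /=.
by rewrite !mxE !mulrDl !mulrA.
Qed.

Lemma formM_linr c u v w : formM w (c *: u + v) = c * formM w u + formM w v.
Proof. by rewrite !(formM_sym w) formM_linl. Qed.

Local Notation E := (vev iota t (sev mulM bvec)).

Lemma lin_basic u : basic u -> lin u = E u.
Proof.
elim: u => [|[s p] u IH] /=; first by rewrite /lin !vev_nil.
case/andP=> s1 /IH; rewrite /lin !vev_cons => ->; congr (_ *: _ + _).
by case: s s1 => [|i []].
Qed.

Lemma full_table_model : table_valid iota t mulM bvec full_table.
Proof.
have H : all (fun x => [&& (x.1.1 < 12)%N, (x.1.2 < 12)%N, basic x.2,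
    basic (tprod x.1.1 x.1.2) & veq (tprod x.1.1 x.1.2) x.2]) full_table.
  by vm_compute.
move=> x /(all_In H)/and5P[x1 x2 bx bt /(vev_eq iota t (sev mulM bvec)) <-].
by rewrite mulM_bvec // lin_basic.
Qed.

Lemma full_gram_model : gram_valid iota t bvec formM full_gram.
Proof.
have H : all (fun x => [&& (x.1.1 < 12)%N, (x.1.2 < 12)%N
    & peq (tform x.1.1 x.1.2) x.2]) full_gram.
  by vm_compute.
move=> x /(all_In H)/and3P[x1 x2 /(peq_pev iota t) <-].
exact: formM_bvec.
Qed.

Local Notation ad := (ad full_table).
Local Notation vmul := (vmul full_table).

Lemma adE g u : mulM (bvec g) (E u) = E (ad g u).
Proof. by rewrite (ad_valid mulM_comm full_table_model). Qed.

Lemma vmulE u w : basic u -> mulM (E u) (E w) = E (vmul u w).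
Proof. by move=> bu; rewrite (vmul_valid mulM_comm full_table_model). Qed.

Lemma E_bas n : E (bas n) = bvec n.
Proof. by rewrite vev_bas. Qed.

End Model.

(** The symbol [[:: k; 0; 0]] stands for the [k]-th vector of [eigs_full g];
    eliminating the basis symbols inverts the eigenbasis. *)
Definition eig_coefs (g i : nat) : seq pol :=
  let b := eigs_full g in
  let tag k := [:: k; 0; 0]%N in
  let rows := [seq vsub (nth (Ev1, [::]) b k).2 [:: (tag k, [:: 1%qq])]
              | k <- iota 0 (size b)] in
  let sol := eliminate (fun s => size s == 1%N) rows in
  let row := flatten [seq x.2 | x <- sol & x.1 == [:: i]] in
  [seq pscale (-1)%qq (vcoef (tag k) row) | k <- iota 0 (size b)].

Definition eig_part (g i : nat) (l : monster_ev) : vec :=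
  vsum [seq vscale x.1 x.2.2
       | x <- zip (eig_coefs g i) (eigs_full g) & ev_eqb l x.2.1].

Section Model.
Variables (R : realType) (S : comNzRingType) (phi : {rmorphism R -> S}).
Variable t : S.

Local Notation V := 'rV[S]_12.
Local Notation mulM := (mulM phi t).
Local Notation formM := (formM phi t).
Local Notation bvec := (bvec S).
Local Notation axM := (axM S).
Local Notation E := (vev phi t (sev mulM bvec)).
Local Notation ad := (ad full_table).
Local Notation vmul := (vmul full_table).
Local Notation eigen := (eigen phi mulM).
Local Notation eigen_sum := (eigen_sum phi mulM).

Let mulP : comm_algebra mulM := mulM_comm phi t.

Let E_eq u w : veq u w -> E u = E w.
Proof. exact: vev_eq. Qed.

Definition in_eig_span (g : nat) (l : monster_ev) (x : V) : Prop :=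
  forall P : V -> Prop, P 0 -> (forall c u v, P u -> P v -> P (c *: u + v)) ->
  (forall b, List.In (l, b) (eigs_full g) -> P (E b)) -> P x.

Lemma eigs_eigen g l b : (g < 6)%N -> List.In (l, b) (eigs_full g) ->
  basic b /\ eigen (bvec g) l (E b).
Proof.
have H : all (fun g => all (is_eigen full_table g) (eigs_full g)) (iota 0 6).
  by vm_compute.
move=> g6 /(all_In (all_iotaP H g6)) ev; split; first by case/andP: ev.
exact: (is_eigen_valid mulP (full_table_model phi t) ev).
Qed.

Lemma in_eig_span_eigen g l x : (g < 6)%N -> in_eig_span g l x ->
  eigen (bvec g) l x.
Proof.
move=> g6; apply=> [|c u v|b /(eigs_eigen g6)[]//].
- exact: eigen0.
- exact: eigen_lin.
Qed.

Lemma eig_decomp g v : (g < 6)%N -> exists f : monster_ev -> V,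
  (forall l, in_eig_span g l (f l)) /\ v = \sum_(l <- monster_all) f l.
Proof.
move=> g6; elim/bvec_ind: v.
- exists (fun=> 0); split=> [l P P0 _ _ //|].
  by rewrite big1.
- move=> c _ _ [f1 [f1P ->]] [f2 [f2P ->]]; exists (fun l => c *: f1 l + f2 l).
  split=> [l P P0 PD Pb|].
    by apply: (PD); [exact: (f1P l P P0 PD Pb)|exact: (f2P l P P0 PD Pb)].
  by rewrite big_split scaler_sumr.
move=> n n12; exists (fun l => E (eig_part g n l)); split=> [l P P0 PD Pb|].
  rewrite /eig_part; move: (eig_coefs g n) Pb.
  elim: (eigs_full g) => [|[m b] s IH] [|c cs] //= Pb; rewrite ?vev_nil //.
  have {}IH := IH cs (fun b bs => Pb b (or_intror bs)).
  case: ev_eqP => [lm|//]; rewrite /= vev_add vev_scale; apply: (PD) => //.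
  by apply: Pb; left; rewrite lm.
have H : all (fun g => all (fun n =>
    veq (vsum [seq eig_part g n l | l <- monster_all]) (bas n))
    (iota 0 12)) (iota 0 6) by vm_compute.
rewrite -(E_bas phi t) -(E_eq (all_iotaP (all_iotaP H g6) n12)) vev_sum big_map.
by [].
Qed.

Lemma eigen_in_span g l u : (g < 6)%N -> eigen (bvec g) l u -> in_eig_span g l u.
Proof.
move=> g6 Eu; have [f [fP uE]] := eig_decomp u g6.
suff -> : u = f l by apply: fP.
have fE m : eigen (bvec g) m (f m) by apply: in_eig_span_eigen.
pose h m := if ev_eqb m l then - u else 0.
have hE m : eigen (bvec g) m (1 *: f m + h m).
  apply: eigen_lin => //; rewrite /h; case: ev_eqP => [->|_]; last exact: eigen0.
  by rewrite -scaleN1r -[_ *: u]addr0; apply: eigen_lin => //; apply: eigen0.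
have S0 : \sum_(m <- monster_all) (1 *: f m + h m) = 0.
  rewrite big_split /= -scaler_sumr -uE scale1r.
  by rewrite /h !big_cons big_nil; case: (l) => /=; rewrite !addr0 ?add0r subrr.
have := eigen_indep mulP hE S0 l; rewrite scale1r /h.
by case: ev_eqP => // _ /eqP; rewrite subr_eq0 => /eqP.
Qed.

Lemma ad_subs_E g u L : foldl (ad_sub phi mulM (bvec g)) (E u) L =
  E (foldl (fun u l => vsub (ad g u) (vscale [:: evq l] u)) u L).
Proof.
elim: L u => //= l L IH u; rewrite -IH; congr (foldl _ _ _).
by rewrite /ad_sub vev_sub vev_scale pevC evqE adE.
Qed.

Definition annihilated (g : nat) (L : seq monster_ev) (u : vec) : bool :=
  veq (foldl (fun u l => vsub (ad g u) (vscale [:: evq l] u)) u L) [::].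

Lemma eigen_sum_E g L u : pairwise (fun l m => ~~ ev_eqb l m) L ->
  annihilated g L u -> eigen_sum (bvec g) L (E u).
Proof.
move=> uL /(vev_eq phi t (sev mulM bvec)); rewrite -ad_subs_E vev_nil.
exact: eigen_sum_annihilated.
Qed.

Lemma fusion_uniq l m : pairwise (fun l m => ~~ ev_eqb l m) (fusion l m).
Proof. by case: l; case: m. Qed.

Lemma axis_fusion_rule g l m u v : (g < 6)%N ->
  eigen (bvec g) l u -> eigen (bvec g) m v ->
  eigen_sum (bvec g) (fusion l m) (mulM u v).
Proof.
move=> g6 /(eigen_in_span g6) + /(eigen_in_span g6).
have H : all (fun g => all (fun x => all (fun y =>
    annihilated g (fusion x.1 y.1) (vmul x.2 y.2)) (eigs_full g)) (eigs_full g))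
    (iota 0 6) by vm_compute.
move=> uP vP.
apply: (uP (fun x => eigen_sum (bvec g) (fusion l m) (mulM x v)))
  => [|c u1 u2|b bP].
- by rewrite (amul0l mulP); exact: (eigen_sum0 phi mulP).
- by rewrite (amulDl mulP) (amulZl mulP); exact: (eigen_sum_lin mulP).
apply: (vP (fun x => eigen_sum (bvec g) (fusion l m) (mulM (E b) x)))
  => [|c u1 u2|b' b'P].
- by rewrite (amul0r mulP); exact: (eigen_sum0 phi mulP).
- by rewrite (amulDr mulP) (amulZr mulP); exact: (eigen_sum_lin mulP).
have [bb _] := eigs_eigen g6 bP.
rewrite (vmulE phi t b' bb).
refine (eigen_sum_E (fusion_uniq l m) _).
exact (all_In (all_In (all_iotaP H g6) bP) b'P).
Qed.

Lemma A_lt6 (g : gen) : (apos g.1 g.2 < 6)%N.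
Proof. by case: g => i []; elim/ord3_ind: i. Qed.

Lemma axM_idem g : (g < 6)%N -> mulM (bvec g) (bvec g) = bvec g.
Proof.
have H : all (fun g => veq (ad g (bas g)) (bas g)) (iota 0 6) by vm_compute.
by move=> g6; rewrite -{2 3}(E_bas phi t) adE (E_eq (all_iotaP H g6)).
Qed.

Lemma axM_axis g : is_axis phi mulM (axM g).
Proof.
have g6 := A_lt6 g; split.
- exact: axM_idem.
- move=> v; have [f [fP vE]] := eig_decomp v g6; exists f; split=> // l.
  exact: in_eig_span_eigen.
- exact: eigen_indep.
- by move=> l m u v; apply: axis_fusion_rule.
Qed.

Lemma axM_primitive g : primitive_axis phi mulM (axM g).
Proof.
have g6 := A_lt6 g; move=> v; split=> [/(eigen_in_span g6) vP|[c ->]].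
  apply: (vP (fun x => exists c, x = c *: axM g))
    => [|c _ _ [c1 ->] [c2 ->]|b bP].
  - by exists 0; rewrite scale0r.
  - by exists (c * c1 + c2); rewrite scalerDl scalerA.
  exists 1; rewrite scale1r.
  have H : all (fun g => all (fun x => ~~ ev_eqb x.1 Ev1 || veq x.2 (bas g))
    (eigs_full g)) (iota 0 6) by vm_compute.
  by rewrite (E_eq (all_In (all_iotaP H g6) bP)) E_bas.
rewrite /Defs.eigen (amulZr mulP) axM_idem //= rmorph1 scale1r.
by [].
Qed.

End Model.

Definition form_assoc_check (i j k : nat) : bool :=
  if (gform full_gram (bas i) (ad full_table j (bas k)),
      gform full_gram (ad full_table i (bas j)) (bas k)) is (Some p, Some q)
  then peq p q else false.

Definition halves (q : Q) (x y : nat) : vec :=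
  vadd [:: cst (1 # 2) x] [:: cst q y].

Definition miyamoto_check (i j : nat) (e d : bool) : bool :=
  let x := apos j d in let y := apos j (if j == i then d else ~~ d) in
  let u := halves (1 # 2) x y in let z := halves (-1 # 2) x y in
  [&& annihilated (apos i e) [:: Ev1; Ev0; Ev4] u,
      veq (ad full_table (apos i e) z) (vscale [:: evq Ev32] z),
      veq (vadd u z) (bas x) & veq (vsub u z) (bas y)].

(** In a 4A algebra, [64 a b - 3 a - 3 b = a' + b' - 3 v], and the remaining
    basis elements are recovered by multiplying this once more by [a] or [b]. *)
Definition word1 (a b : nat) : vec :=
  vsub (vscale [:: 64%qq] (vmul full_table (bas a) (bas b)))
       [:: cst 3 a; cst 3 b].
Definition word2 (a b : nat) : vec :=
  vscale [:: (1 # 14)%qq] (vsub (vadd (vscale [:: 64%qq]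
    (ad full_table b (word1 a b))) [:: cst 57 b; cst (-25) a])
    (vscale [:: 13%qq] (word1 a b))).
Definition word3 (a b : nat) : vec :=
  vscale [:: (1 # 3)%qq] (vsub (vadd (word2 a b) (word2 b a)) (word1 a b)).

Definition third (i j : nat) : nat := (3 - (i + j))%N.

Definition base4A (i j : nat) : seq nat :=
  [:: apos i true; apos i false; apos j true; apos j false; vpos (third i j)].

Definition words_check (i j : nat) : bool :=
  let a := apos i true in let b := apos j true in
  [&& basic (word1 a b), basic (word2 a b),
      veq (word2 a b) (bas (apos i false)), veq (word2 b a) (bas (apos j false))
    & veq (word3 a b) (bas (vpos (third i j)))].

Definition closed_check (L : seq nat) : bool :=
  all (fun x => all (fun y => let r := ad full_table x (bas y) in
    basic r && all (fun z => head 0%N z.1 \in L) r) L) L.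

Definition table4A_check (i j : nat) : bool :=
  let v := vpos (third i j) in
  [&& veq (ad full_table v (bas v)) (bas v),
      all (fun e => all (fun d => veq (ad full_table (apos i e) (bas (apos j d)))
        (axax_vec (apos i e) (apos j d) (apos i (~~ e)) (apos j (~~ d)) v))
        signs) signs,
      all (fun e => veq (ad full_table (apos i e) (bas v))
        (axv_vec (apos i e) (apos i (~~ e)) (apos j true) (apos j false) v)) signs
    & veq (ad full_table (apos i true) (bas (apos i false))) [::]].

Definition gram4A_check (i j : nat) : bool :=
  let v := vpos (third i j) in
  [&& all (fun e => all (fun d => peq (tform (apos i e) (apos j d)) [:: evq Ev32])
        signs) signs,
      peq (tform (apos i true) (apos i false)) [::],
      all (fun e => peq (tform (apos i e) v) [:: (3 # 8)%qq]) signs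
    & peq (tform v v) [:: 2%qq]].

Definition check_pairs (p : nat -> nat -> bool) : bool :=
  all (fun i => all (fun j => (i == j) || p i j) (iota 0 3)) (iota 0 3).

Lemma check_pairsP p (i j : 'I_3) : check_pairs p -> i != j -> p i j.
Proof.
move=> H ij; have := all_iotaP (all_iotaP H (ltn_ord i)) (ltn_ord j).
by rewrite val_eqE (negPf ij).
Qed.

Lemma all_signs (p : bool -> bool) e : all p signs -> p e.
Proof. by case: e => /and3P[]. Qed.

Definition triple_check (i j k : nat) : bool :=
  [|| i == j, j == k, i == k | all (fun d => all (fun e => all (fun s =>
    if gform full_gram (bas (apos i d))
             (ad full_table (apos j e) (bas (apos k s)))
      is Some p then peq p [:: (1 # 256)%qq; (-3 # 64)%qq] else false)
    signs) signs) signs].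

Lemma triples : all (fun i => all (fun j => all (triple_check i j) (iota 0 3))
  (iota 0 3)) (iota 0 3).
Proof. by vm_compute. Qed.

Section Model.
Variables (R : realType) (S : comNzRingType) (phi : {rmorphism R -> S}).
Variable t : S.

Local Notation W := 'rV[S]_12.
Local Notation mulM := (mulM phi t).
Local Notation formM := (formM phi t).
Local Notation bvec := (bvec S).
Local Notation axM := (axM S).
Local Notation E := (vev phi t (sev mulM bvec)).
Local Notation ad := (ad full_table).
Local Notation vmul := (vmul full_table).

Let mulP : comm_algebra mulM := mulM_comm phi t.
Let tabP := full_table_model phi t.
Let gramP := full_gram_model phi t.

Let E_eq u w : veq u w -> E u = E w.
Proof. exact: vev_eq. Qed.

Lemma formM_assoc u v w : formM u (mulM v w) = formM (mulM u v) w.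
Proof.
have lin_l := formM_linl phi t; have lin_r := formM_linr phi t.
have H : all (fun i => all (fun j => all (fun k => form_assoc_check i j k)
    (iota 0 12)) (iota 0 12)) (iota 0 12) by vm_compute.
have f0l x : formM 0 x = 0.
  exact: (form0l lin_l).
have f0r x : formM x 0 = 0 by rewrite formM_sym.
elim/bvec_ind: u => [|c u1 u2 H1 H2|i i12].
- by rewrite (amul0l mulP) !f0l.
- by rewrite (amulDl mulP) (amulZl mulP) !lin_l H1 H2.
elim/bvec_ind: v => [|c v1 v2 H1 H2|j j12].
- by rewrite (amul0l mulP) (amul0r mulP) f0l f0r.
- by rewrite (amulDl mulP) (amulDr mulP) (amulZl mulP) (amulZr mulP) lin_r lin_l
    H1 H2.
elim/bvec_ind: w => [|c w1 w2 H1 H2|k k12].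
- by rewrite (amul0r mulP) !f0r.
- by rewrite (amulDr mulP) (amulZr mulP) !lin_r H1 H2.
have := all_iotaP (all_iotaP (all_iotaP H i12) j12) k12.
rewrite /form_assoc_check.
case E1 : (gform _ _ _) => [p|//]; case E2 : (gform _ _ _) => [q|//] pq.
have := gform_valid mulM lin_l (@formM_sym _ _ phi t) gramP E1.
rewrite -(adE phi t) !(E_bas phi t) => ->.
have := gform_valid mulM lin_l (@formM_sym _ _ phi t) gramP E2.
rewrite -(adE phi t) !(E_bas phi t) => ->.
exact: peq_pev.
Qed.

Lemma mulM_ad x y : mulM (bvec x) (bvec y) = E (ad x (bas y)).
Proof. by rewrite -adE E_bas. Qed.

Section Subalgebra.
Variable P : W -> Prop.
Hypothesis PS : subalgebra mulM P.

Let P0 : P 0. Proof. by case: PS. Qed.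
Let PD u v : P u -> P v -> P (u + v).
Proof. by case: PS => _ H _ _; apply: (H). Qed.
Let PZ c u : P u -> P (c *: u). Proof. by case: PS => _ _ H _; apply: (H). Qed.
Let PM u v : P u -> P v -> P (mulM u v).
Proof. by case: PS => _ _ _ H; apply: (H). Qed.
Let PB u v : P u -> P v -> P (u - v).
Proof. by move=> Pu Pv; rewrite -scaleN1r; apply: PD => //; apply: PZ. Qed.

Lemma subalgebra_4A (i j : 'I_3) : i != j ->
    P (axM (i, true)) -> P (axM (j, true)) ->
  [/\ P (axM (i, false)), P (axM (j, false)) & P (bvec (vpos (third i j)))].
Proof.
move=> ij Pa Pb.
have H : check_pairs words_check by vm_compute.
have /and5P[] := check_pairsP H ij.
have w1P x y : P (bvec x) -> P (bvec y) -> P (E (word1 x y)).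
  move=> Px Py; rewrite /word1 vev_sub vev_scale.
  have -> : E (vmul (bas x) (bas y)) = mulM (bvec x) (bvec y).
    by rewrite -(E_bas phi t x) -(E_bas phi t y) (@vmulE _ _ phi t (bas x)).
  rewrite !vev_cons vev_nil.
  apply: PB; first exact/PZ/PM.
  by apply: PD; first exact: PZ; apply: PD; first exact: PZ.
have w2P x y : P (bvec x) -> P (bvec y) -> P (E (word2 x y)).
  move=> Px Py; rewrite /word2 vev_scale vev_sub vev_add !vev_scale.
  rewrite -(adE phi t y (word1 x y)) !vev_cons vev_nil.
  have w1 := w1P x y Px Py; apply: PZ.
  apply: PB; last exact: PZ.
  apply: PD; first by apply: PZ; apply: PM.
  by apply: PD; first exact: PZ; apply: PD; first exact: PZ.
move=> _ _ /E_eq w2 /E_eq w2' /E_eq w3.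
rewrite /axM /= -!(E_bas phi t) -w2 -w2' -w3.
have w1 := w1P _ _ Pa Pb.
have {w2P} [wab wba] := (w2P _ _ Pa Pb, w2P _ _ Pb Pa).
split; [exact: wab|exact: wba|].
rewrite /word3 vev_scale vev_sub vev_add; apply: PZ.
by apply: PB; last exact: w1; apply: PD.
Qed.

Lemma subalgebra_full v : (forall g, P (axM g)) -> P v.
Proof.
move=> Pax.
have [_ _ Pv3] := @subalgebra_4A i1 i2 isT (Pax _) (Pax _).
have [_ _ Pv2] := @subalgebra_4A i1 i3 isT (Pax _) (Pax _).
have [_ _ Pv1] := @subalgebra_4A i2 i3 isT (Pax _) (Pax _).
have Pv (k : 'I_3) : P (bvec (vpos k)) by elim/ord3_ind: k.
have H : all (fun i => veq (vsub (ad (apos i true) (bas (vpos i)))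
  [:: tms 1 (apos i true)]) (bas (ypos i))) (iota 0 3) by vm_compute.
have Py (k : 'I_3) : P (bvec (ypos k)).
  rewrite -(E_bas phi t) -(E_eq (all_iotaP H (ltn_ord k))) vev_sub -adE E_bas.
  rewrite vev_cons vev_nil addr0; apply: PB; last exact/PZ/(Pax (k, true)).
  by apply: PM => //; apply: (Pax (k, true)).
elim/bvec_ind: v => [//|c u w Pu Pw|n n12]; first by apply: PD => //; apply: PZ.
do 6 ?[case: n n12 => [|n] n12]; first exact: (Pax (i1, true)).
- exact: (Pax (i1, false)).
- exact: (Pax (i2, true)).
- exact: (Pax (i2, false)).
- exact: (Pax (i3, true)).
- exact: (Pax (i3, false)).
case: n n12 => [|[|[|[|[|[|//]]]]]] _.
- exact: (Pv i1).
- exact: (Pv i2).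
- exact: (Pv i3).
- exact: (Py i1).
- exact: (Py i2).
- exact: (Py i3).
Qed.

End Subalgebra.

Lemma model_monster_axial : monster_axial phi mulM axM.
Proof.
split=> [|g|v P PS Pax]; [exact: mulM_comm|exact: axM_axis|].
by apply: (subalgebra_full PS) => g; apply: Pax; exists g.
Qed.

Lemma tform_ax (g : gen) : pev phi t (tform (apos g.1 g.2) (apos g.1 g.2)) = 1.
Proof.
have H : all (fun i => peq (tform i i) [:: 1%qq]) (iota 0 6) by vm_compute.
have /(peq_pev phi t) -> := all_iotaP H (A_lt6 g).
by rewrite pev1.
Qed.

Lemma ax_lt12 (g : gen) : (apos g.1 g.2 < 12)%N.
Proof. exact: leq_trans (A_lt6 g) _. Qed.

Lemma model_primitive_frobenius :
  primitive_frobenius_axial phi mulM axM formM.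
Proof.
have ax1 g : formM (axM g) (axM g) = 1.
  by rewrite formM_bvec ?ax_lt12 // tform_ax.
split=> // [|g|]; [exact: model_monster_axial|exact: axM_primitive|].
split=> [c u v w|c u v w|u v w|].
- exact: formM_linl.
- exact: formM_linr.
- exact: formM_assoc.
exists (axM (i1, true)), (axM (i1, true)); rewrite ax1.
exact/eqP/oner_neq0.
Qed.

Lemma model_propertyP : propertyP phi mulM axM.
Proof.
have H : all (fun i => all (fun j => all (fun e => all (fun d =>
    miyamoto_check i j e d) signs) signs) (iota 0 3)) (iota 0 3) by vm_compute.
move=> i j e d.
have := all_iotaP (all_iotaP H (ltn_ord i)) (ltn_ord j).
move=> /(all_signs e)/(all_signs d).
rewrite /miyamoto_check /= val_eqE.
set x := apos j d; set y := apos j _.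
set u := halves _ _ _; set z := halves _ _ _.
case/and4P=> Hu /E_eq Hz /E_eq Hx /E_eq Hy.
exists (E u), (E z); split.
- exact: eigen_sum_E.
- by rewrite /eigen adE Hz vev_scale pevC -evqE.
- by rewrite -vev_add Hx E_bas.
- by rewrite -vev_sub Hy E_bas.
Qed.

Definition vM (i j : 'I_3) : W := bvec (vpos (third i j)).

Lemma vMC i j : vM i j = vM j i.
Proof. by rewrite /vM /third addnC. Qed.

Section Span.
Variable L : seq nat.
Hypothesis L5 : size L = 5%N.

Definition spanned (x : W) : Prop :=
  exists c : nat -> S, x = \sum_(k < 5) c k *: bvec (nth 0%N L k).

Lemma spanned0 : spanned 0.
Proof. by exists (fun=> 0); rewrite big1 // => k _; rewrite scale0r. Qed.

Lemma spanned_lin c u v : spanned u -> spanned v -> spanned (c *: u + v).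
Proof.
move=> [c1 ->] [c2 ->]; exists (fun k => c * c1 k + c2 k).
rewrite scaler_sumr -big_split; apply: eq_bigr => k _ /=.
by rewrite scalerA scalerDl.
Qed.

Lemma spanned_bvec n : n \in L -> spanned (bvec n).
Proof.
move=> nL; have := nL; rewrite -index_mem L5 => n5.
exists (fun k => (k == index n L)%:R).
rewrite (bigD1 (Ordinal n5)) //= eqxx scale1r nth_index // big1 ?addr0 // => k kn.
by rewrite (_ : (k == index n L :> nat) = false) ?scale0r //; apply: negbTE.
Qed.

Lemma spanned_mul u v : closed_check L -> spanned u -> spanned v ->
  spanned (mulM u v).
Proof.
move=> H [c ->] vP.
have sl w1 w2 : spanned w1 -> spanned w2 -> spanned (w1 + w2).
  by move=> *; rewrite -[w1]scale1r; apply: spanned_lin.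
have sz d w : spanned w -> spanned (d *: w).
  by move=> *; rewrite -[_ *: _]addr0; apply: spanned_lin => //; apply: spanned0.
have nL (k : 'I_5) : nth 0%N L k \in L by rewrite mem_nth // L5.
elim/big_ind: _ => [|u1 u2 H1 H2|k _].
- by rewrite (amul0l mulP); apply: spanned0.
- by rewrite (amulDl mulP); apply: (sl).
rewrite (amulZl mulP); apply: (sz); case: vP => c' ->.
elim/big_ind: _ => [|u1 u2 H1 H2|l _].
- by rewrite (amul0r mulP); apply: spanned0.
- by rewrite (amulDr mulP); apply: (sl).
rewrite (amulZr mulP); apply: (sz); rewrite mulM_ad.
have /allP/(_ _ (nL k))/allP/(_ _ (nL l))/andP[] := H.
elim: (ad _ _) => [|[s p] r IH] /=.
  by rewrite vev_nil => *; apply: spanned0.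
case/andP=> s1 br /andP[sL rL]; rewrite vev_cons; apply: (sl); last exact: IH.
by apply: (sz); case: s s1 sL => [|m []] // _ mL; apply: spanned_bvec.
Qed.

End Span.

Lemma model_type4A (i j : 'I_3) : i != j ->
  type4A phi mulM axM formM i j (vM i j).
Proof.
move=> ij.
have Ht : check_pairs table4A_check by vm_compute.
have Hg : check_pairs gram4A_check by vm_compute.
have Hc : check_pairs (fun i j => closed_check (base4A i j)) by vm_compute.
have /and4P[/E_eq tv taa tav /E_eq topp] := check_pairsP Ht ij.
have ji : j != i by rewrite eq_sym.
have /and4P[_ _ tavj /E_eq toppj] := check_pairsP Ht ji.
have /and4P[gaa gopp gav gvv] := check_pairsP Hg ij.
have /and4P[_ goppj gavj _] := check_pairsP Hg ji.
have v12 : (vpos (third i j) < 12)%N.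
  rewrite /vpos /third -[12%N]/(6 + 6)%N ltn_add2l ltnS.
  exact: leq_trans (leq_subr _ _) _.
have a12 x e : (apos (x : 'I_3) e < 12)%N := ax_lt12 (x, e).
have th : third j i = third i j by rewrite /third addnC.
split.
- move=> x; split.
    move=> /(_ (spanned (base4A i j)))[].
    + split; [exact: spanned0|move=> u v su sv; rewrite -[u]scale1r|
        move=> c u su; rewrite -[_ *: _]addr0|move=> u v su sv].
      * exact: spanned_lin.
      * by apply: spanned_lin => //; apply: spanned0.
      * by apply: spanned_mul => //; apply: (check_pairsP Hc ij).
    + by move=> _ [] ->; apply: spanned_bvec => //; rewrite !inE eqxx ?orbT.
    move=> c ->; exists (c 0%N), (c 1%N), (c 2%N), (c 3%N), (c 4%N).
    by rewrite !big_ord_recr big_ord0 /= add0r.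
  move=> [c1 [c2 [c3 [c4 [c5 ->]]]]] P PS Pax.
  have Pa : P (axM (i, true)) by apply: Pax; left.
  have Pb : P (axM (j, true)) by apply: Pax; right.
  have [Pa' Pb' Pv] := subalgebra_4A PS ij Pa Pb.
  case: PS => P0 PD PZ _.
  by do 4!(apply: (PD); last exact: PZ); exact: PZ.
- by rewrite /vM mulM_ad tv E_bas.
- split; [move=> e d|split=> e].
  + by rewrite /axM mulM_ad (E_eq (all_signs d (all_signs e taa))) vev_axax.
  + by rewrite /axM mulM_ad (E_eq (all_signs e tav)) vev_axv.
  + by rewrite vMC /axM mulM_ad (E_eq (all_signs e tavj)) vev_axv.
- by split; rewrite /axM mulM_ad ?topp ?toppj vev_nil.
have v38 : pev phi t [:: (3 # 8)%qq] = phi (3 / 8) by rewrite pevC.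
split.
- move=> e d; rewrite [LHS](formM_bvec phi t (a12 i e) (a12 j d)).
  by rewrite (peq_pev _ _ (all_signs d (all_signs e gaa))) pevC evqE.
- split.
    by rewrite [LHS](formM_bvec phi t (a12 i _) (a12 i _)) (peq_pev _ _ gopp).
  by rewrite [LHS](formM_bvec phi t (a12 j _) (a12 j _)) (peq_pev _ _ goppj).
- move=> e; rewrite [LHS](formM_bvec phi t (a12 i e) v12).
  by rewrite (peq_pev _ _ (all_signs e gav)) v38.
- move=> e; rewrite [LHS](formM_bvec phi t (a12 j e) v12) -th.
  by rewrite (peq_pev _ _ (all_signs e gavj)) v38.
rewrite [LHS](formM_bvec phi t v12 v12) (peq_pev _ _ gvv) pevC.
by rewrite (_ : qev R _ = 2%:R / 1) // divr1 rmorph_nat.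
Qed.

Lemma model_shape4A : shape4A phi mulM axM formM.
Proof. by exists vM; split; [exact: vMC|exact: model_type4A]. Qed.

Lemma model_t : formM (axM (i1, true)) (vM i2 i3) = t.
Proof.
have E : peq (tform 0 6) [:: 0%qq; 1%qq] by vm_compute.
have [n0 n6] : (0 < 12)%N /\ (6 < 12)%N by [].
rewrite [LHS](formM_bvec phi t n0 n6) (peq_pev _ _ E) pev_lin qev1 rmorph1.
exact: mulr1.
Qed.

Lemma form_triple (g h k : gen) : g.1 != h.1 -> h.1 != k.1 -> g.1 != k.1 ->
  formM (axM g) (mulM (axM h) (axM k)) = phi 256^-1 - phi (3 / 64) * t.
Proof.
case: g h k => i d [j e] [k s] /= ij jk ik.
have H := all_iotaP (all_iotaP triples (ltn_ord i)) (ltn_ord j).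
have {H} := all_iotaP H (ltn_ord k).
rewrite /triple_check !val_eqE (negPf ij) (negPf jk) (negPf ik) !orFb.
move=> /(all_signs d)/(all_signs e)/(all_signs s).
case G : (gform _ _ _) => [p|//] /(peq_pev phi t) Ep.
have := gform_valid mulM (formM_linl phi t) (@formM_sym _ _ phi t) gramP G.
rewrite -adE !E_bas Ep /axM /= => ->.
rewrite mulr0 addr0 qevN rmorphN mulrN [t * _]mulrC.
have -> : qev R (1 # 256) = 256^-1 by rewrite -[RHS]mul1r.
by have -> : qev R (3 # 64) = 3 / 64 by [].
Qed.

End Model.

(** * The universal algebra *)

Section CommutativeMonomials.
Variables (I : choiceType) (S : comNzRingType) (F : I -> S).

Definition cmonom_eval (m : {cmonom I}) : S := \prod_(i <- finsupp m) F i ^+ m i.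

Lemma cmonom_evalEw (m : {cmonom I}) (d : {fset I}) : (finsupp m `<=` d)%fset ->
  cmonom_eval m = \prod_(i <- d) F i ^+ m i.
Proof.
move=> md; rewrite /cmonom_eval (big_fset_incl _ md) // => i _.
by rewrite -cmE_eq0 => /eqP ->; rewrite expr0.
Qed.

Lemma cmonom_eval_mmorphism : mmorphism cmonom_eval.
Proof.
split=> [m1 m2|]; last by rewrite /cmonom_eval mdom1 big_seq_fset0.
rewrite (@cmonom_evalEw m1 (finsupp m1 `|` finsupp m2)%fset) ?fsubsetUl //.
rewrite (@cmonom_evalEw m2 (finsupp m1 `|` finsupp m2)%fset) ?fsubsetUr //.
rewrite /cmonom_eval mdomD -big_split; apply: eq_bigr => i _ /=.
by rewrite cmM exprD.
Qed.

HB.instance Definition _ :=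
  monalg.isMultiplicative.Build {cmonom I} S cmonom_eval cmonom_eval_mmorphism.

Lemma cmonom_eval_ucm i : cmonom_eval (ucm i) = F i.
Proof. by rewrite /cmonom_eval mdomU big_seq_fset1 cmUU expr1. Qed.

Lemma cmonom_eval_unique (h : {cmonom I} -> S) : mmorphism h ->
  (forall i, h (ucm i) = F i) -> h =1 cmonom_eval.
Proof.
move=> [hM h1] hU m; have [n] := ubnP (mdeg m).
elim: n m => // n IH m /ltnSE mn; have [/eqP|m0] := eqVneq (mdeg m) 0%N.
  by rewrite mdeg_eq0 => /eqP ->; rewrite h1 (cmonom_eval_mmorphism.2).
have [i im] : exists i, i \in finsupp m.
  apply/fset0Pn; apply: contra_neq m0 => E.
  by rewrite mdegE E big_seq_fset0.
have Em : m = mmul (ucm i) (divcm m (ucm i)).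
  apply/eqP/cmP => j; rewrite cmM divcmE subnKC // cmU.
  by case: eqP => // <-; rewrite lt0n cmE_neq0.
rewrite Em hM hU (cmonom_eval_mmorphism.1) cmonom_eval_ucm IH //.
apply: leq_trans mn; rewrite [in X in (_ < X)%N]Em mdegM mdegU.
by rewrite add1n.
Qed.

End CommutativeMonomials.

Section Evaluation.
Variables (R : realType) (S : comNzRingType) (phi : {rmorphism R -> S}).
Variables (V : lmodType S) (mul : V -> V -> V) (ax : gen -> V).
Variable form : V -> V -> S.
Hypothesis mulP : comm_algebra mul.
Hypothesis formDl : forall c u v w, form (c *: u + v) w = c * form u w + form v w.
Hypothesis formDr : forall c u v w, form w (c *: u + v) = c * form w u + form w v.
Hypothesis formA : forall u v w, form u (mul v w) = form (mul u v) w.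

Fixpoint tree_eval (x : tree) : V :=
  match x with
  | Leaf g => ax g
  | Node x y => mul (tree_eval x) (tree_eval y)
  end.

Lemma tree_eval_eqv x y : tree_eqv x y -> tree_eval x = tree_eval y.
Proof.
elim: x y => [g|x1 IH1 x2 IH2] [h|y1 y2] //=; first by move/eqP->.
by case/orP=> /andP[/IH1 -> /IH2 ->] //; rewrite (amulC mulP).
Qed.

Definition magma_eval (x : magma) : V := tree_eval (repr x).

Lemma magma_eval_pi x : magma_eval (\pi_magma x)%qT = tree_eval x.
Proof.
apply: tree_eval_eqv.
have : (\pi_magma (repr (\pi_magma x)) = \pi_magma x)%qT by rewrite reprK.
by move/eqmodP.
Qed.

Lemma magma_eval_gen g : magma_eval (magma_gen g) = ax g.
Proof. exact: magma_eval_pi. Qed.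

Lemma magma_eval_mul x y :
  magma_eval (magma_mul x y) = mul (magma_eval x) (magma_eval y).
Proof. exact: magma_eval_pi. Qed.

Definition form_at (p : magma * magma) : S :=
  form (magma_eval p.1) (magma_eval p.2).

Lemma form_at_eqv p q : assoc_eqv p q -> form_at p = form_at q.
Proof.
move/asboolP; elim=> {p q} [_ _ [x y z]|//|p q _ -> //|p q r _ -> _ -> //].
by rewrite /form_at /= !magma_eval_mul formA.
Qed.

Definition lambda_eval (i : lambda_index) : S := form_at (repr i).

Lemma lambda_eval_pi p : lambda_eval (\pi_lambda_index p)%qT = form_at p.
Proof.
apply: form_at_eqv.
have : (\pi_lambda_index (repr (\pi_lambda_index p)) = \pi_lambda_index p)%qT.
  by rewrite reprK.
by move/eqmodP.
Qed.

Definition coef_eval : Rhat R -> S := mmap phi (cmonom_eval lambda_eval).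

HB.instance Definition _ := GRing.RMorphism.on coef_eval.

Lemma coef_evalC c : coef_eval c%:MP = phi c.
Proof. exact: mmapC. Qed.

Lemma coef_eval_lambda x y :
  coef_eval (lambda R x y) = form (magma_eval x) (magma_eval y).
Proof.
rewrite /coef_eval /lambda mmapU /= rmorph1 mul1r cmonom_eval_ucm.
exact: lambda_eval_pi.
Qed.

Definition vect_eval (u : Mhat R) : V :=
  \sum_(x <- msupp u) coef_eval u@_x *: magma_eval x.

Lemma vect_evalEw (u : Mhat R) (d : {fset magma}) : (msupp u `<=` d)%fset ->
  vect_eval u = \sum_(x <- d) coef_eval u@_x *: magma_eval x.
Proof.
move=> ud; rewrite /vect_eval (big_fset_incl _ ud) // => x _ /mcoeff_outdom ->.
by rewrite rmorph0 scale0r.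
Qed.

Lemma vect_eval_lin r u v :
  vect_eval (r *: u + v) = coef_eval r *: vect_eval u + vect_eval v.
Proof.
pose d := (msupp u `|` msupp v `|` msupp (r *: u + v))%fset.
rewrite (@vect_evalEw u d); last by rewrite /d -fsetUA fsubsetUl.
rewrite (@vect_evalEw v d); last by rewrite /d fsetUAC fsubsetUr.
rewrite (@vect_evalEw (_ + _) d); last by rewrite /d fsubsetUr.
rewrite scaler_sumr -big_split; apply: eq_bigr => x _ /=.
by rewrite mcoeffD mcoeffZ rmorphD rmorphM scalerDl scalerA.
Qed.

Lemma vect_evalU c x : vect_eval << c *g x >> = coef_eval c *: magma_eval x.
Proof. by rewrite (vect_evalEw msuppU_le) big_seq_fset1 mcoeffUU. Qed.

Lemma vect_eval0 : vect_eval 0 = 0.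
Proof. by rewrite /vect_eval msupp0 big_seq_fset0. Qed.

Lemma vect_evalD u v : vect_eval (u + v) = vect_eval u + vect_eval v.
Proof. by rewrite -[u]scale1r vect_eval_lin rmorph1 !scale1r. Qed.

Lemma vect_eval_sum (I : Type) (r : seq I) (G : I -> Mhat R) :
  vect_eval (\sum_(i <- r) G i) = \sum_(i <- r) vect_eval (G i).
Proof. exact: (big_morph _ vect_evalD vect_eval0). Qed.

Lemma vect_eval_gen g : vect_eval (Mgen R g) = ax g.
Proof. by rewrite vect_evalU rmorph1 scale1r magma_eval_gen. Qed.

Lemma vect_eval_mul u v : vect_eval (Mmul u v) = mul (vect_eval u) (vect_eval v).
Proof.
have mul_suml (r : seq magma) (G : magma -> V) w :
    mul (\sum_(x <- r) G x) w = \sum_(x <- r) mul (G x) w.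
  apply: (big_morph (fun z => mul z w)); last exact: amul0l.
  by move=> *; apply: amulDl.
rewrite /Mmul vect_eval_sum /vect_eval mul_suml; apply: eq_bigr => x _.
rewrite (amulC mulP) mul_suml -/(vect_eval _) vect_eval_sum.
apply: eq_bigr => y _.
rewrite vect_evalU rmorphM magma_eval_mul (amulC mulP) (amulZl mulP).
by rewrite (amulZr mulP) scalerA [coef_eval _ * _]mulrC.
Qed.

Lemma vect_eval_form u v :
  form (vect_eval u) (vect_eval v) = coef_eval (Mform u v).
Proof.
have f0l w : form 0 w = 0 by exact: (form0l formDl).
have f0r w : form w 0 = 0.
  by apply: (addrI (1 * form w 0)); rewrite -formDr scale1r addr0 mul1r addr0.
rewrite /Mform raddf_sum {1}/vect_eval.
elim: (msupp u : seq _) => [|x r IH]; first by rewrite !big_nil f0l.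
rewrite !big_cons formDl IH; congr (_ + _) => {IH}.
rewrite raddf_sum /vect_eval.
elim: (msupp v : seq _) => [|y r' IH]; first by rewrite !big_nil f0r mulr0.
rewrite !big_cons formDr mulrDr IH; congr (_ + _).
by rewrite -[RHS]/(coef_eval _) !rmorphM /= coef_eval_lambda mulrA.
Qed.

Section Unique.
Variables (pR : {rmorphism Rhat R -> S}) (pM : Mhat R -> V).
Hypothesis pRC : forall c : R, pR c%:MP = phi c.
Hypothesis pM_lin : forall r u v, pM (r *: u + v) = pR r *: pM u + pM v.
Hypothesis pM_mul : forall u v, pM (Mmul u v) = mul (pM u) (pM v).
Hypothesis pM_form : forall u v, form (pM u) (pM v) = pR (Mform u v).
Hypothesis pM_gen : forall g, pM (Mgen R g) = ax g.

Lemma MmulU (x y : magma) : Mmul << x >> << y >> = << magma_mul x y >> :> Mhat R.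
Proof. by rewrite /Mmul !msuppU oner_eq0 !big_seq_fset1 !mcoeffUU mulr1. Qed.

Lemma MformU (x y : magma) : Mform << x >> << y >> = lambda R x y.
Proof. by rewrite /Mform !msuppU oner_eq0 !big_seq_fset1 !mcoeffUU !mul1r. Qed.

Lemma pM_tree x : pM << (\pi_magma x)%qT >> = tree_eval x.
Proof.
elim: x => [g|y IHy z IHz] /=; first exact: pM_gen.
rewrite -IHy -IHz -pM_mul MmulU; congr (pM << _ >>).
apply/eqmodP => /=; apply/orP; left; apply/andP.
by split; apply/eqmodP; rewrite reprK.
Qed.

Lemma pM_magma x : pM << x >> = magma_eval x.
Proof. by rewrite -[x]reprK pM_tree magma_eval_pi. Qed.

Lemma pR_unique r : pR r = coef_eval r.
Proof.
have pRm m : pR << m >> = cmonom_eval lambda_eval m.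
  apply: (@cmonom_eval_unique _ _ _ (fun m => pR << m >>)) => [|i].
    split=> [m1 m2|]; last exact: rmorph1.
    rewrite -rmorphM; congr (pR _).
    by rewrite malgM_def; apply/esym; rewrite fgmulUU mulr1.
  rewrite -[i]reprK; case: (repr i) => x y; rewrite lambda_eval_pi /form_at /=.
  by rewrite -!pM_magma pM_form MformU.
have pRU c m : pR << c *g m >> = phi c * cmonom_eval lambda_eval m.
  have -> : << c *g m >> = c%:MP * << m >> :> Rhat R.
    by rewrite malgM_def; apply/esym; rewrite fgmulUU mulr1 mul1m.
  by rewrite (rmorphM pR); congr (_ * _); [exact: (pRC c)|exact: (pRm m)].
rewrite /coef_eval mmapE {1}[r]monalgE raddf_sum.
by apply: eq_bigr => m _; apply: pRU.
Qed.

Lemma pM_unique u : pM u = vect_eval u.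
Proof.
have pM0 : pM 0 = 0.
  by have := pM_lin (-1) 0 0; rewrite scaler0 addr0 rmorphN1 scaleN1r addNr.
have pMD v w : pM (v + w) = pM v + pM w.
  by rewrite -[v]scale1r pM_lin rmorph1 !scale1r.
rewrite {1}[u]monalgE (big_morph _ pMD pM0); apply: eq_bigr => x _.
have -> : << u@_x *g x >> = u@_x *: << x >> + 0 :> Mhat R.
  by rewrite addr0; apply/malgP => k; rewrite mcoeffZ !mcoeffU mulr_natr.
by rewrite pM_lin pM0 addr0 pM_magma pR_unique.
Qed.

End Unique.
End Evaluation.

Definition full_check (i j : nat) : bool :=
  [&& isSome (lookup full_table i j), isSome (lookup full_gram i j),
      basic (tprod i j) & all (fun x => head 0%N x.1 < 12)%N (tprod i j)].

Section ModelMap.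
Variables (R : realType) (S S' : comNzRingType).
Variables (phi : {rmorphism R -> S}) (phi' : {rmorphism R -> S'}).
Variables (f : {rmorphism S -> S'}) (t : S) (t' : S').
Hypotheses (f_phi : forall c, f (phi c) = phi' c) (f_t : f t = t').
Variables (V : lmodType S') (mul : V -> V -> V) (e : nat -> V).
Hypothesis mulP : comm_algebra mul.
Hypothesis tabP : table_valid phi' t' mul e full_table.

Local Notation mulM := (mulM phi t).
Local Notation formM := (formM phi t).
Local Notation bvec := (bvec S).
Local Notation axM := (axM S).

Lemma pev_morph p : f (pev phi t p) = pev phi' t' p.
Proof.
by elim: p => [|c p IH] /=; rewrite ?rmorph0 // rmorphD rmorphM f_phi f_t IH.
Qed.

Definition model_map (v : 'rV[S]_12) : V := \sum_(i < 12) f (v 0 i) *: e i.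

Lemma model_map_lin c u v :
  model_map (c *: u + v) = f c *: model_map u + model_map v.
Proof.
rewrite /model_map scaler_sumr -big_split; apply: eq_bigr => i _ /=.
by rewrite !mxE rmorphD rmorphM scalerDl scalerA.
Qed.

Lemma model_map0 : model_map 0 = 0.
Proof. by rewrite /model_map big1 // => i _; rewrite mxE rmorph0 scale0r. Qed.

Lemma model_map_bvec n : (n < 12)%N -> model_map (bvec n) = e n.
Proof.
move=> n12; rewrite /model_map (bigD1 (Ordinal n12)) //= mxE eqxx rmorph1 scale1r.
rewrite big1 ?addr0 // => i ni; rewrite mxE (_ : (i == n :> nat) = false).
  by rewrite rmorph0 scale0r.
exact: negbTE.
Qed.

Lemma full_checkP i j : (i < 12)%N -> (j < 12)%N -> full_check i j.
Proof.
have H : all (fun i => all (full_check i) (iota 0 12)) (iota 0 12).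
  by vm_compute.
by move=> i12 j12; have := all_iotaP (all_iotaP H i12) j12.
Qed.

Lemma model_map_lincomb r : basic r -> all (fun x => head 0%N x.1 < 12)%N r ->
  model_map (lin phi t r) = vev phi' t' (sev mul e) r.
Proof.
elim: r => [|[s p] r IH] /=; first by rewrite /lin !vev_nil model_map0.
case/andP=> s1 br /andP[s12 r12]; rewrite /lin !vev_cons model_map_lin /=.
rewrite -/(lin phi t r) IH // pev_morph; congr (_ *: _ + _).
by case: s s1 s12 => [|n []] // _; apply: model_map_bvec.
Qed.

Lemma model_map_mul u v : model_map (mulM u v) = mul (model_map u) (model_map v).
Proof.
have PM := mulM_comm phi t.
elim/bvec_ind: u => [|c u1 u2 H1 H2|i i12].
- by rewrite (amul0l PM) model_map0 (amul0l mulP).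
- by rewrite (amulDl PM) (amulZl PM) !model_map_lin H1 H2 (amulDl mulP)
    (amulZl mulP).
elim/bvec_ind: v => [|c v1 v2 H1 H2|j j12].
- by rewrite (amul0r PM) model_map0 (amul0r mulP).
- by rewrite (amulDr PM) (amulZr PM) !model_map_lin H1 H2 (amulDr mulP)
    (amulZr mulP).
have /and4P[Hl _ Hb H12] := full_checkP i12 j12.
rewrite (mulM_bvec phi t i12 j12) (model_map_lincomb Hb H12).
rewrite (model_map_bvec i12) (model_map_bvec j12).
case E : (lookup full_table i j) Hl => [r|//] _.
by rewrite (lookup_valid mulP tabP E) /tprod E.
Qed.

Variable form : V -> V -> S'.
Hypothesis formDl : forall c u v w, form (c *: u + v) w = c * form u w + form v w.
Hypothesis formC : forall u v, form u v = form v u.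
Hypothesis gramP : gram_valid phi' t' e form full_gram.

Lemma model_map_form u v : form (model_map u) (model_map v) = f (formM u v).
Proof.
have Ml := formM_linl phi t.
have form0 := form0l formDl; have formM0 := form0l Ml.
elim/bvec_ind: u => [|c u1 u2 H1 H2|i i12].
- by rewrite model_map0 form0 formM0 rmorph0.
- by rewrite model_map_lin formDl Ml H1 H2 rmorphD rmorphM.
rewrite formC (formM_sym phi t).
elim/bvec_ind: v => [|c v1 v2 H1 H2|j j12].
- by rewrite model_map0 form0 formM0 rmorph0.
- by rewrite model_map_lin formDl Ml H1 H2 rmorphD rmorphM.
have /and4P[_ Hl _ _] := full_checkP j12 i12.
rewrite (formM_bvec phi t j12 i12) pev_morph.
rewrite (model_map_bvec i12) (model_map_bvec j12).
case E : (lookup full_gram j i) Hl => [r|//] _.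
by rewrite (glookup_valid formC gramP E) /tform E.
Qed.

End ModelMap.

Section Universal.
Variable R : realType.

Let phi : {rmorphism R -> {poly R}} := polyC.
Local Notation mulX := (mulM phi 'X).
Local Notation formX := (formM phi 'X).
Local Notation axX := (axM {poly R}).

Definition M4A : form_algebra R :=
  @FormAlgebra R {poly R} phi 'rV[{poly R}]_12 mulX formX axX.

Let mulXP : comm_algebra mulX := mulM_comm phi 'X.
Let formXA := @formM_assoc R {poly R} phi 'X.
Let formXDl := formM_linl phi 'X.
Let formXDr := formM_linr phi 'X.

Local Notation pR := (coef_eval phi mulX axX formX).
Local Notation pM := (vect_eval phi mulX axX formX).

Definition ker_vect : set (Mhat R) := [set u | pM u = 0]%classic.
Definition ker_coef : set (Rhat R) := [set r | pR r = 0]%classic.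

Lemma coef_surj s : exists r, pR r = s.
Proof.
have rD a b : pR (a + b) = pR a + pR b by rewrite rmorphD.
have rM a b : pR (a * b) = pR a * pR b by rewrite rmorphM.
have rC (c : R) : pR c%:MP = c%:P by exact: coef_evalC.
have [x Ex] : exists x, pR x = 'X.
  pose g (i : 'I_3) := magma_gen (i, true).
  have := coef_eval_lambda phi axX mulXP formXA (g i1) (magma_mul (g i2) (g i3)).
  rewrite (magma_eval_mul axX mulXP) !(magma_eval_gen axX mulXP).
  rewrite (@form_triple R {poly R} phi 'X (i1, true) (i2, true) (i3, true)) //.
  move: (lambda R _ _) => l El; exists ((12^-1)%:MP + (- (64 / 3))%:MP * l).
  rewrite rD rM El; move: (rC 12^-1) (rC (- (64 / 3))).
  move: (_%:MP) (_%:MP) => l1 l2 -> ->.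
  rewrite mulrBr mulrA -!polyCM.
  have -> : - (64 / 3) / 256 = - 12^-1 :> R by field.
  have -> : - (64 / 3) * (3 / 64) = -1 :> R by field.
  by rewrite !polyCN !mulNr opprK mul1r addrA subrr add0r.
elim/poly_ind: s => [|p c [r Er]]; first by exists 0; rewrite rmorph0.
by exists (r * x + c%:MP); rewrite rD rM Er Ex rC.
Qed.

Lemma vect_surj x : exists u, pM u = x.
Proof.
pose P x := exists u, pM u = x.
have lin u v c : P u -> P v -> P (c *: u + v).
  move=> [u' <-] [v' <-]; have [r <-] := coef_surj c.
  by exists (r *: u' + v'); rewrite vect_eval_lin.
have P0 : P 0 by exists 0; rewrite vect_eval0.
apply: (@subalgebra_full R {poly R} phi 'X P); last first.
  by move=> g; exists (Mgen R g); apply: vect_eval_gen.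
split=> // [u v Pu Pv|c u Pu|u v [u' <-] [v' <-]].
- by rewrite -[u]scale1r; apply: lin.
- by rewrite -[_ *: _]addr0; apply: lin.
by exists (Mmul u' v'); apply: vect_eval_mul.
Qed.

Lemma M4A_quotient : @quotient_by R M4A ker_vect ker_coef.
Proof.
exists pR, pM; split.
- by split=> // [s|c]; [apply: coef_surj|apply: coef_evalC].
- by split=> // [r u v|x]; [apply: vect_eval_lin|apply: vect_surj].
- by move=> u v; apply: vect_eval_mul.
- by move=> u v; apply: vect_eval_form.
- by move=> g; apply: vect_eval_gen.
Qed.

Lemma ker_ideal_pair : ideal_pair ker_vect ker_coef.
Proof.
split.
- split=> [|u v|c u|u v]; rewrite /ker_vect /=.
  + exact: vect_eval0.
  + by rewrite vect_evalD => -> ->; rewrite addr0.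
  + by move=> E; rewrite -[_ *: _]addr0 vect_eval_lin E vect_eval0 scaler0 addr0.
  + move=> E; have EM x y : pM (Mmul x y) = mulX (pM x) (pM y).
      exact: vect_eval_mul.
    split; [transitivity (mulX (pM u) (pM v))|transitivity (mulX (pM v) (pM u))].
    * exact: EM.
    * by rewrite E; exact: (amul0l mulXP).
    * exact: EM.
    * by rewrite E; exact: (amul0r mulXP).
- split=> [|r s|c r|]; rewrite /ker_coef /=.
  + exact: rmorph0.
  + by rewrite rmorphD /= => -> ->; rewrite addr0.
  + by rewrite rmorphM /= => ->; rewrite mulr0.
  + by exists 1; rewrite rmorph1; apply/eqP/oner_neq0.
- move=> r u; rewrite /ker_coef /ker_vect /= => E.
  by rewrite -[_ *: _]addr0 vect_eval_lin E scale0r add0r vect_eval0.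
move=> u v; rewrite /ker_coef /ker_vect /= => E.
have EF : formX (pM u) (pM v) = pR (Mform u v) by exact: vect_eval_form.
by rewrite -EF E (form0l formXDl).
Qed.

Lemma M4A_in_C4A : in_C4A ker_vect ker_coef.
Proof.
split; first exact: ker_ideal_pair.
exists M4A; split.
- exact: M4A_quotient.
- exact: model_primitive_frobenius.
- exact: model_propertyP.
- exact: model_shape4A.
Qed.

Section Least.
Variables (I : set (Mhat R)) (J : set (Rhat R)) (Q : form_algebra R).
Variables (pR' : {rmorphism Rhat R -> fa_ring Q}) (pM' : Mhat R -> Q).
Hypotheses (pR'C : forall c : R, pR' c%:MP = fa_real Q c)
  (pR'0 : forall r, pR' r = 0 <-> J r) (pM'0 : forall u, pM' u = 0 <-> I u).
Hypothesis pM'_lin : forall r u v, pM' (r *: u + v) = pR' r *: pM' u + pM' v.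
Hypothesis pM'_mul : forall u v, pM' (Mmul u v) = fa_mul (pM' u) (pM' v).
Hypothesis pM'_form : forall u v, fa_form (pM' u) (pM' v) = pR' (Mform u v).
Hypothesis pM'_gen : forall g, pM' (Mgen R g) = fa_ax Q g.
Hypothesis PF : primitive_frobenius_axial (fa_real Q) (@fa_mul R Q) (@fa_ax R Q)
  (@fa_form R Q).
Variable vs : 'I_3 -> 'I_3 -> Q.
Hypothesis vsC : forall i j, vs i j = vs j i.
Hypothesis vsP : forall i j, i != j ->
  type4A (fa_real Q) (@fa_mul R Q) (@fa_ax R Q) (@fa_form R Q) i j (vs i j).

Let t' := fa_form (fa_ax Q (i1, true)) (vs i2 i3).

Lemma horner_comm : commr_rmorph (fa_real Q) t'.
Proof. by move=> c; apply: mulrC. Qed.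

Let f : {rmorphism {poly R} -> fa_ring Q} := horner_morph horner_comm.
Let e := elt (@fa_mul R Q) (@fa_ax R Q) (@fa_form R Q) vs.
Let Phi := model_map f e.

Let f_phi c : f (phi c) = fa_real Q c. Proof. exact: horner_morphC. Qed.
Let f_X : f 'X = t'. Proof. exact: horner_morphX. Qed.
Let QP : comm_algebra (@fa_mul R Q). Proof. by case: PF => -[]. Qed.
Let valid := full_gram_table_valid PF vsC vsP.

Lemma Phi_mul u v : Phi (mulX u v) = fa_mul (Phi u) (Phi v).
Proof. by case: valid => _ H; apply: (model_map_mul f_phi f_X QP H). Qed.

Lemma Phi_form u v : fa_form (Phi u) (Phi v) = f (formX u v).
Proof.
case: valid => H _.
exact: (model_map_form f_phi f_X (formDl PF) (formC PF) H).
Qed.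

Lemma Phi_ax g : Phi (axX g) = fa_ax Q g.
Proof.
rewrite /Phi /axM model_map_bvec ?ax_lt12 // /e.
by case: g => i s; apply: eltA.
Qed.

Local Notation magma_evalX := (magma_eval mulX axX).
Local Notation magma_evalQ := (magma_eval (@fa_mul R Q) (@fa_ax R Q)).

Lemma Phi_magma x : magma_evalQ x = Phi (magma_evalX x).
Proof.
rewrite /magma_eval; elim: (repr x) => [g|y IHy z IHz] /=.
  by rewrite Phi_ax.
by rewrite IHy IHz Phi_mul.
Qed.

Lemma f_coef r :
  coef_eval (fa_real Q) (@fa_mul R Q) (@fa_ax R Q) (@fa_form R Q) r = f (pR r).
Proof.
rewrite /coef_eval !mmapE raddf_sum; apply: eq_bigr => m _.
rewrite [RHS](rmorphM f) f_phi; congr (_ * _).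
rewrite /cmonom_eval (rmorph_prod f); apply: eq_bigr => i _.
rewrite (rmorphXn f); congr (_ ^+ _).
by rewrite /lambda_eval /form_at !Phi_magma Phi_form.
Qed.

Lemma Phi_vect u :
  vect_eval (fa_real Q) (@fa_mul R Q) (@fa_ax R Q) (@fa_form R Q) u = Phi (pM u).
Proof.
have PhiD x y : Phi (x + y) = Phi x + Phi y.
  by rewrite -[x]scale1r /Phi model_map_lin rmorph1 !scale1r.
have Phi0 : Phi 0 = 0 := model_map0 f e.
have PhiZ c x : Phi (c *: x) = f c *: Phi x.
  by rewrite -[c *: x]addr0 /Phi model_map_lin model_map0 addr0.
rewrite /vect_eval (big_morph _ PhiD Phi0); apply: eq_bigr => x _.
by rewrite f_coef Phi_magma PhiZ.
Qed.

Lemma ker_least : (ker_vect `<=` I /\ ker_coef `<=` J)%classic.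
Proof.
have QA := formA PF; have Ql := formDl PF; have Qr := formDr PF.
split=> [u uI|r rJ].
  apply/pM'0; rewrite (pM_unique QP QA pR'C pM'_lin pM'_mul pM'_form pM'_gen).
  by rewrite Phi_vect uI; apply: model_map0.
apply/pR'0; rewrite (pR_unique QP QA pR'C pM'_mul pM'_form pM'_gen).
by rewrite f_coef rJ rmorph0.
Qed.

End Least.

Lemma M4A_is_M4A : is_M4A M4A.
Proof.
exists ker_vect, ker_coef; split; [exact: M4A_in_C4A| |exact: M4A_quotient].
move=> I J [_ [Q [[pR' [pM' [[_ pR0 pRC] [pMl _ pM0] pMm pMf pMg]]] PF _]]].
case=> vs [vsC vsP].
exact: (ker_least pRC pR0 pM0 pMl pMm pMf pMg PF vsC vsP).
Qed.

End Universal.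

(** * The specialisations *)

(** [x (x - 1/4) (x - 1/32)], evaluated at the multiplication by [a_g], kills
    the eigenspaces other than the line of [a_g]. *)
Definition proj_vec (g : nat) (u : vec) : vec :=
  let u1 := ad full_table g u in let u2 := ad full_table g u1 in
  vadd (ad full_table g u2)
    (vadd (vscale [:: (-9 # 32)%qq] u2) (vscale [:: (1 # 128)%qq] u1)).

Definition proj_check (g n : nat) : bool :=
  veq (proj_vec g (bas n))
      (vscale (pscale (93 # 128)%qq (tform g n)) (bas g)).

(** The inverse of the Gram matrix, times [gram_den]. *)
Definition gram_adj (m n : nat) : pol :=
  let same i j (p q : pol) := if i == j then p else q in
  if (m < 6)%N then
    if (n < 6)%N then
      if m == n then [:: 0; -189 # 2; 625; -680; 192]%qq
      else same m./2 n./2 [:: 0; -27 # 2; 67; -232; 96]%qq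
                          [:: 0; 0; -74; 152; -48]%qq
    else if (n < 9)%N then
      same m./2 (n - 6)%N [:: 0; -9; 114; -60]%qq [:: 0; 18; -60; 12]%qq
    else same m./2 (n - 9)%N [:: 0; 132; -640; 288]%qq [:: 0; -12; 288; -96]%qq
  else if (m < 9)%N then
    if (n < 6)%N then
      same n./2 (m - 6)%N [:: 0; -9; 114; -60]%qq [:: 0; 18; -60; 12]%qq
    else if (n < 9)%N then same m n [:: 0; -117 # 2; 51]%qq [:: 0; 9; 21]%qq
    else same (m - 6)%N (n - 9)%N [:: 0; 336; -216]%qq [:: 0; -204; 24]%qq
  else
    if (n < 6)%N then
      same n./2 (m - 9)%N [:: 0; 132; -640; 288]%qq [:: 0; -12; 288; -96]%qq
    else if (n < 9)%N then
      same (n - 6)%N (m - 9)%N [:: 0; 336; -216]%qq [:: 0; -204; 24]%qq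
    else same m n [:: -360; -736; 576]%qq [:: 72; 800; -192]%qq.

(** [t (6 t - 1) (9 - 4 t)^2] *)
Definition gram_den : pol := [:: 0; -81; 558; -448; 96]%qq.

Definition gram_adj_check (m n : nat) : bool :=
  peq (foldr padd [::] [seq pmul (gram_adj m k) (tform k n) | k <- iota 0 12])
      (if m == n then gram_den else [::]).

(** Bases [w] of ideals of the specialisation at [q], with the positions at
    which they form a unit matrix. *)
Definition ideal_base (n : nat) : Q * seq nat * seq vec :=
  let sy i := [:: cst (-1 # 12) 0; cst (-1 # 12) 1; cst (-1 # 12) 2;
      cst (-1 # 12) 3; cst (-1 # 12) 4; cst (-1 # 12) 5; cst 1 (ypos i)] in
  match n with
  | 0%N => (0%qq, [:: 9; 10; 11]%N, [:: bas 9; bas 10; bas 11])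
  | 1%N => ((1 # 6)%qq, [:: 9; 10; 11]%N,
      [:: [:: cst (1 # 8) 7, cst (1 # 8) 8 & sy 0%N];
          [:: cst (1 # 8) 6, cst (1 # 8) 8 & sy 1%N];
          [:: cst (1 # 8) 6, cst (1 # 8) 7 & sy 2%N]])
  | _ => ((9 # 4)%qq, [:: 7; 8; 9; 10; 11]%N,
      [:: [:: cst 2 0; cst 2 1; cst (-2) 2; cst (-2) 3; cst (-1) 6; cst 1 7];
          [:: cst 2 0; cst 2 1; cst (-2) 4; cst (-2) 5; cst (-1) 6; cst 1 8];
          [:: cst (7 # 8) 0; cst (7 # 8) 1; cst (-1 # 4) 2; cst (-1 # 4) 3;
              cst (-1 # 4) 4; cst (-1 # 4) 5; cst (-3 # 8) 6; cst 1 9];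
          [:: cst (1 # 2) 0; cst (1 # 2) 1; cst (1 # 8) 2; cst (1 # 8) 3;
              cst (-1 # 4) 4; cst (-1 # 4) 5; cst (-3 # 8) 6; cst 1 10];
          [:: cst (1 # 2) 0; cst (1 # 2) 1; cst (-1 # 4) 2; cst (-1 # 4) 3;
              cst (1 # 8) 4; cst (1 # 8) 5; cst (-3 # 8) 6; cst 1 11]])
  end.

Definition pzero_at (q : Q) (p : pol) : bool :=
  Qeq_bool 0%qq (foldr (fun c r => qadd c (qmul q r)) 0%qq p).

Definition ideal_check (b : Q * seq nat * seq vec) : bool :=
  let: (q, pv, ws) := b in
  all (fun w => basic w && all (fun n =>
    let r := vmul full_table w (bas n) in
    all (fun x => pzero_at q x.2)
      (vsub r (vsum [seq vscale (vcoef [:: x.1] r) x.2 | x <- zip pv ws])))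
    (iota 0 12)) ws.

Definition free_check (b : Q * seq nat * seq vec) : bool :=
  let: (q, pv, ws) := b in
  (size pv == size ws) && all (fun i => (nth 0%N pv i < 12)%N && all (fun j =>
    peq (vcoef [:: nth 0%N pv i] (nth [::] ws j)) [:: if i == j then 1 else 0]%qq)
    (iota 0 (size ws))) (iota 0 (size ws)).

Lemma checks :
  [/\ all (fun g => all (proj_check g) (iota 0 12)) (iota 0 6),
      all (fun m => all (gram_adj_check m) (iota 0 12)) (iota 0 12)
    & all (fun n => ideal_check (ideal_base n) && free_check (ideal_base n))
        (iota 0 3)].
Proof. by split; vm_compute. Qed.

Section RealModels.
Variable R : realType.

Let idR : {rmorphism R -> R} := idfun.
Local Notation W := 'rV[R]_12.
Local Notation E t := (vev idR t (sev (mulM idR t) (bvec R))).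

Definition Mt (t : R) : real_algebra R :=
  @RealAlgebra R 'rV[R]_12 (mulM idR t) (formM idR t) (axM R).

Lemma dim_Mt t : \dim {:Mt t} = 12%N.
Proof. by rewrite dimvf /dim /=. Qed.

Lemma Mt_monster t : real_monster_axial (Mt t).
Proof. exact: model_monster_axial. Qed.

Definition v23 : M4A R := vM {poly R} i2 i3.

Lemma v23_type4A : type4A_in i2 i3 v23.
Proof. exact: (@model_type4A R {poly R} polyC 'X i2 i3 isT). Qed.

Lemma t_M4A : fa_form (fa_ax (M4A R) (i1, true)) v23 = 'X.
Proof. exact: model_t. Qed.

Lemma Mt_specialisation t :
  specialisation (fa_form (fa_ax (M4A R) (i1, true)) v23) t (Mt t).
Proof.
rewrite t_M4A.
pose ev : {rmorphism {poly R} -> R} := horner_eval t.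
have evC (c : R) : ev c%:P = idR c by rewrite /ev /= /horner_eval hornerC.
have evX : ev 'X = t by rewrite /ev /= /horner_eval hornerX.
have PR := mulM_comm idR t; have tabP := full_table_model idR t.
have gramP := full_gram_model idR t.
pose p := model_map ev (bvec R).
have pE x i : p x 0 i = (x 0 i).[t].
  have -> : p x = map_mx ev x by rewrite [RHS]row_bvec; apply: eq_bigr => j _;
    rewrite mxE.
  by rewrite mxE.
have tX : 'X - @fa_real R (M4A R) t = 'X - t%:P by [].
exists ev, p; split; rewrite ?tX.
- split=> [c|s]; first exact: evC.
  split=> [/rootP/factor_theorem[q ->]|[c ->]]; first by exists q; rewrite mulrC.
  by rewrite rmorphM rmorphB evX evC /= subrr mul0r.
- split=> [s x y|z|x].
  + exact: model_map_lin.
  + exists (map_mx polyC z); apply/rowP => i.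
    by rewrite pE mxE hornerC.
  split=> [px0|[y ->]].
    exists (\row_i ((x 0 i) %/ ('X - t%:P))); apply/rowP => i.
    rewrite !mxE mulrC divpK // dvdp_XsubCl; apply/rootP.
    by rewrite -pE px0 mxE.
  apply/rowP => i; rewrite pE !mxE hornerM hornerXsubC subrr mul0r.
  by [].
- move=> x y; exact: (model_map_mul evC evX PR tabP).
- move=> x y; exact: (model_map_form evC evX (formM_linl idR t)
    (@formM_sym _ _ idR t) gramP).
- by move=> g; apply: model_map_bvec; apply: ax_lt12.
Qed.

Section Fixed.
Variable t : R.
Local Notation mul := (mulM idR t).
Local Notation form := (formM idR t).
Let PR : comm_algebra mul := mulM_comm idR t.

Definition ax_proj (a x : W) : W :=
  mul a (mul a (mul a x)) + (- (9 / 32) *: mul a (mul a x) + 128^-1 *: mul a x).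

Lemma ax_proj_lin a c u v :
  ax_proj a (c *: u + v) = c *: ax_proj a u + ax_proj a v.
Proof.
rewrite /ax_proj !(amulDr PR, amulZr PR) !scalerDr !scalerA.
rewrite ![_ * c]mulrC.
by rewrite [X in _ + X = _]addrACA; exact: addrACA.
Qed.

Lemma ax_proj_E g u : ax_proj (bvec R g) (E t u) = E t (proj_vec g u).
Proof.
rewrite /ax_proj /proj_vec !vev_add !vev_scale -!(adE idR t g) !pevC qevN.
rewrite (_ : qev R (9 # 32) = 9%:R / 32%:R) //.
by rewrite (_ : qev R (1 # 128) = 1 / 128%:R) // mul1r.
Qed.

Lemma ax_projE g u : (g < 6)%N -> ax_proj (bvec R g) u =
  (93 / 128 * form (bvec R g) u) *: bvec R g.
Proof.
move=> g6; have g12 : (g < 12)%N by apply: leq_trans g6 _.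
have [H _ _] := checks.
have f0 x : form x 0 = 0 by rewrite formM_sym (form0l (formM_linl idR t)).
elim/bvec_ind: u => [|c u1 u2 H1 H2|n n12].
- by rewrite /ax_proj !(amul0r PR) f0 !scaler0 mulr0 scale0r !addr0.
- by rewrite ax_proj_lin H1 H2 formM_linr scalerA -scalerDl mulrDr mulrCA.
have /(vev_eq idR t (sev mul (bvec R))) := all_iotaP (all_iotaP H g6) n12.
rewrite -ax_proj_E vev_scale pev_scale !E_bas => ->.
rewrite (formM_bvec idR t g12 n12).
by rewrite (_ : qev R (93 # 128) = 93%:R / 128%:R).
Qed.

End Fixed.

End RealModels.

Section Isomorphism.
Variable R : realType.

Let idR : {rmorphism R -> R} := idfun.
Local Notation W := 'rV[R]_12.

Lemma bvec_neq0 n : (n < 12)%N -> bvec R n <> 0.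
Proof.
by move=> n12 /rowP/(_ (Ordinal n12))/eqP; rewrite !mxE eqxx oner_eq0.
Qed.

Lemma bvec_scale_inj n (c d : R) : (n < 12)%N -> c *: bvec R n = d *: bvec R n ->
  c = d.
Proof.
by move=> n12 /rowP/(_ (Ordinal n12)); rewrite !mxE eqxx !mulr1.
Qed.

Lemma axM_form t (g h : gen) : g.1 != h.1 ->
  formM idR t (axM R g) (axM R h) = 32^-1.
Proof.
by case: g h => i d [j e] /= /(model_type4A idR t)[_ _ _ _ []].
Qed.

Lemma axM_mul_neq0 t (g h : gen) : g.1 != h.1 ->
  mulM idR t (axM R g) (axM R h) <> 0.
Proof.
move=> gh E; have := axM_form t gh.
rewrite -[X in formM _ _ _ X](axM_idem idR t (A_lt6 h)) formM_assoc.
rewrite [mulM _ _ _ _]E (form0l (formM_linl idR t)) => /esym/eqP.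
by rewrite invr_eq0 pnatr_eq0.
Qed.

Lemma axM_mul_same t (g h : gen) : g.1 = h.1 -> g <> h ->
  mulM idR t (axM R g) (axM R h) = 0.
Proof.
case: g h => i d [j e] /= -> {i} gh.
have [k jk] := exists_other j.
have [_ _ _ [H _] _] := model_type4A idR t jk.
by case: d e gh => [] [] // _; rewrite (amulC (mulM_comm idR t)).
Qed.

Lemma axM_neq (g h : gen) : g.1 != h.1 -> axM R g <> axM R h.
Proof.
move=> /(axM_form 0) + E; rewrite -E formM_bvec ?ax_lt12 // tform_ax.
move/eqP; rewrite -{1}[1]invr1 (inj_eq invr_inj) eq_sym pnatr_eq1.
by [].
Qed.

Lemma axial_isomorphic_eq (s t : R) : axial_isomorphic (Mt s) (Mt t) -> s = t.
Proof.
move=> [f [/bij_inj f_inj fM fax _]].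
have f_proj a x : f (ax_proj s a x) = ax_proj t (f a) (f x).
  by rewrite /ax_proj !linearD !linearZ !fM.
have [h1 E1] := fax (i1, true); have [h2 E2] := fax (i2, true).
have [h3 E3] := fax (i3, true).
have distinct g g' h h' : g.1 != g'.1 -> f (axM R g) = axM R h ->
    f (axM R g') = axM R h' -> h.1 != h'.1.
  move=> gg' Eg Eg'; apply/eqP => hh'; apply: (axM_mul_neq0 (t := s) gg').
  apply: (f_inj); rewrite linear0 fM Eg Eg'; apply: axM_mul_same => // hE.
  by apply: (axM_neq gg'); apply: (f_inj); rewrite Eg Eg' hE.
have d12 := distinct (i1, true) (i2, true) _ _ isT E1 E2.
have d23 := distinct (i2, true) (i3, true) _ _ isT E2 E3.
have d13 := distinct (i1, true) (i3, true) _ _ isT E1 E3.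
have := f_proj (axM R (i1, true))
  (mulM idR s (axM R (i2, true)) (axM R (i3, true))).
rewrite (ax_projE _ _ (A_lt6 (i1, true))) linearZ fM [f _]E1 [f _]E2 [f _]E3.
rewrite (ax_projE _ _ (A_lt6 h1)) (form_triple idR t d12 d23 d13).
rewrite [formM _ _ _ _](@form_triple R R idR s (i1, true) (i2, true) (i3, true)) //.
move=> /(bvec_scale_inj (ax_lt12 h1))/mulfI.
rewrite mulf_neq0 ?invr_eq0 ?pnatr_eq0 // => /(_ isT)/addrI/oppr_inj.
apply: mulfI.
by rewrite mulf_neq0 ?invr_eq0 ?pnatr_eq0.
Qed.

End Isomorphism.

Lemma sum_delta (S : pzSemiRingType) n (m : 'I_n) (c : S) (F : 'I_n -> S) :
  \sum_j (if m == j then c else 0) * F j = c * F m.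
Proof.
rewrite (bigD1 m) //= eqxx big1 ?addr0 // => j jm.
by rewrite eq_sym (negPf jm) mul0r.
Qed.

Section Ideals.
Variables (R : realType) (t : R).

Let idR : {rmorphism R -> R} := idfun.
Local Notation W := 'rV[R]_12.
Local Notation mul := (mulM idR t).
Local Notation form := (formM idR t).
Local Notation E := (vev idR t (sev mul (bvec R))).
Let PR : comm_algebra mul := mulM_comm idR t.

Lemma gram_nondegenerate (u : W) : t <> 0 -> t <> 1 / 6 -> t <> 9 / 4 ->
  (forall n, (n < 12)%N -> form (bvec R n) u = 0) -> u = 0.
Proof.
move=> t0 t6 t4 H; have [_ C _] := checks.
have d0 : pev idR t gram_den != 0.
  have -> : pev idR t gram_den = t * (6 * t - 1) * (9 - 4 * t) ^+ 2.
    rewrite /gram_den /= !qevN /idR /=.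
    have qZ p n : Pos.to_nat p = n -> qev R (Zpos p # 1) = n%:R.
      by move=> <-; rewrite /qev /= divr1.
    rewrite qev0 (qZ 81%positive 81%N erefl) (qZ 558%positive 558%N erefl).
    rewrite (qZ 448%positive 448%N erefl) (qZ 96%positive 96%N erefl).
    ring.
  have t6' : 6 * t - 1 != 0.
    apply/eqP => /eqP; rewrite subr_eq0 => /eqP E; apply: t6.
    have six : (6 : R) != 0 by rewrite pnatr_eq0.
    by apply: (mulfI six); rewrite E; field.
  have t4' : 9 - 4 * t != 0.
    apply/eqP => /eqP; rewrite subr_eq0 => /eqP E; apply: t4.
    have four : (4 : R) != 0 by rewrite pnatr_eq0.
    by apply: (mulfI four); rewrite -E; field.
  have t0' : t != 0 by apply/eqP.
  exact (mulf_neq0 (mulf_neq0 t0' t6') (expf_neq0 2 t4')).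
have uE n (n12 : (n < 12)%N) : form (bvec R n) u =
    \sum_(j < 12) pev idR t (tform n j) * u 0 j.
  rewrite /formM.
  transitivity (\sum_i bvec R n 0 i *:
      (\sum_(j < 12) pev idR t (tform i j) * u 0 j : R^o)).
    apply: eq_bigr => i _; rewrite scaler_sumr; apply: eq_bigr => j _.
    by rewrite -mulrA; congr (_ * _); rewrite mulrC.
  by rewrite (sum_bvec n12).
apply/rowP => m; rewrite mxE; apply: (mulfI d0); rewrite mulr0.
transitivity (\sum_(k < 12) pev idR t (gram_adj m k) * form (bvec R k) u);
  last first.
  by apply: big1 => k _; rewrite (H k (ltn_ord k)) mulr0.
transitivity (\sum_(j < 12)
    (\sum_(k < 12) pev idR t (gram_adj m k) * pev idR t (tform k j)) * u 0 j).
  have adjE (j : 'I_12) : \sum_(k < 12)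
      pev idR t (gram_adj m k) * pev idR t (tform k j) =
      if m == j then pev idR t gram_den else 0.
    have := all_iotaP (all_iotaP C (ltn_ord m)) (ltn_ord j).
    move=> /(peq_pev idR t); rewrite val_eqE => Em.
    transitivity (pev idR t (if m == j then gram_den else [::]));
      last by case: eqP.
    rewrite -Em -(big_mkord predT (fun k => pev idR t (gram_adj m k) *
      pev idR t (tform k j))) /index_iota subn0.
    elim: (iota 0 12) => [|k s IH]; first by rewrite big_nil.
    by rewrite big_cons IH /= pev_add pev_mul.
  transitivity (\sum_(j < 12) (if m == j then pev idR t gram_den else 0) * u 0 j).
    exact (esym (sum_delta m (pev idR t gram_den) (fun j => u 0 j))).
  by apply: eq_bigr => j _; rewrite (adjE j).
transitivity (\sum_(k < 12) \sum_(j < 12)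
    pev idR t (gram_adj m k) * (pev idR t (tform k j) * u 0 j)).
  rewrite exchange_big; apply: eq_bigr => j _; rewrite mulr_suml.
  by apply: eq_bigr => k _; rewrite mulrA.
by apply: eq_bigr => k _; rewrite (uE k (ltn_ord k)) mulr_sumr.
Qed.

Lemma Mt_simple : t <> 0 -> t <> 1 / 6 -> t <> 9 / 4 -> simple_algebra (Mt t).
Proof.
move=> t0 t6 t4; split.
  exists (axM R (i1, true)), (axM R (i1, true)).
  rewrite [ra_mul _ _](axM_idem idR t (A_lt6 (i1, true))).
  exact: bvec_neq0 (ax_lt12 (i1, true)).
move=> U UI; have UM (x y : W) : x \in U -> mul x y \in U.
  by move=> xU; have [] := UI x y xU.
have UM' (x y : W) : y \in U -> mul x y \in U.
  by move=> yU; have [] := UI y x yU.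
have f0 x : form x 0 = 0 by rewrite formM_sym (form0l (formM_linl idR t)).
have [[g [u uU gu]]|none] := pselect (exists g, exists2 u : W, u \in U &
    form (axM R g) u <> 0); last first.
  left; apply/eqP; rewrite -subv0; apply/subvP => u uU; rewrite memv0.
  apply/eqP; apply: (gram_nondegenerate t0 t6 t4) => n _.
  pose P (w : W) := forall x : W, x \in U -> form w x = 0.
  suff PP w : P w by apply: PP.
  apply: (@subalgebra_full R R idR t P) => [|g x xU]; last first.
    by have [//|/eqP gx] := eqVneq (form (axM R g) x) 0; case: none; exists g, x.
  split=> [x _|w1 w2 P1 P2 x xU|c w1 P1 x xU|w1 w2 P1 P2 x xU].
  - exact: form0l (formM_linl idR t) x.
  - by rewrite -[w1]scale1r formM_linl P1 // P2 // mulr0 addr0.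
  - rewrite -[_ *: _]addr0 formM_linl P1 // (form0l (formM_linl idR t)).
    by rewrite mulr0 addr0.
  - by rewrite -formM_assoc P1 //; apply: UM'.
right; apply/eqP; rewrite eqEsubv subvf; apply/subvP => w _.
have projU h (x : W) : x \in U -> form (axM R h) x <> 0 -> axM R h \in U.
  move=> xU /eqP hx; have : ax_proj t (axM R h) x \in U.
    by rewrite /ax_proj !rpredD ?rpredZ // !UM'.
  rewrite (ax_projE t x (A_lt6 h)) => /(rpredZ (93 / 128 * form (axM R h) x)^-1).
  rewrite scalerA mulVf ?scale1r // mulf_neq0 //.
  by rewrite mulf_neq0 ?invr_eq0 ?pnatr_eq0.
have step g1 g2 : g1.1 != g2.1 -> axM R g1 \in U -> axM R g2 \in U.
  move=> g12 gU; apply: (projU _ _ gU).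
  rewrite axM_form 1?eq_sym //; apply/eqP.
  by rewrite invr_eq0 pnatr_eq0.
have gU := projU g u uU gu.
apply: (@subalgebra_full R R idR t (fun x => x \in U)).
  split=> [|x y xU yU|c x xU|x y xU _].
  - exact: rpred0.
  - exact: rpredD.
  - exact: rpredZ.
  - exact: UM.
move=> h; have [gh|gh] := boolP (g.1 == h.1); last exact: step gU.
have [k gk] := exists_other g.1.
apply: (step (k, true)); first by rewrite /= -(eqP gh) eq_sym.
exact: step gU.
Qed.

End Ideals.

Section SpecialIdeals.
Variables (R : realType) (q : Q).

Let idR : {rmorphism R -> R} := idfun.
Let t : R := qev R q.
Local Notation W := 'rV[R]_12.
Local Notation mul := (mulM idR t).
Local Notation E := (vev idR t (sev mul (bvec R))).
Let PR : comm_algebra mul := mulM_comm idR t.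

Lemma pzero_at_pev p : pzero_at q p -> pev idR t p = 0.
Proof.
move=> /Qeq_bool_eq /(qev_eq R); rewrite qev0 => ->.
by elim: p => [|c p IH] /=; [rewrite qev0 | rewrite qev_add qev_mul -IH].
Qed.

Lemma lin_coord u (j : 'I_12) : basic u ->
  lin idR t u 0 j = pev idR t (vcoef [:: j : nat] u).
Proof.
rewrite /lin; elim: u => [|[s p] u IH] /=; first by rewrite vev_nil mxE.
case: s => [|i []] // /IH{}IH.
rewrite vev_cons !mxE IH /= eqseq_cons andbT eq_sym.
by case: eqP => _ /=; rewrite ?pev_add ?mulr1 // mulr0 add0r.
Qed.

Variables (pv : seq nat) (ws : seq vec).
Let X := [tuple of [seq E w | w <- in_tuple ws]].

Lemma mem_span w : w \in ws -> E w \in <<X>>%VS.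
Proof. by move=> wws; apply: memv_span; apply: map_f. Qed.

Lemma ideal_span : ideal_check (q, pv, ws) -> @is_ideal R (Mt t) <<X>>%VS.
Proof.
move=> /allP H x y xX.
suff mX : mul x y \in <<X>>%VS by split=> //; rewrite [ra_mul _ _](amulC PR).
elim/bvec_ind: y => [|c y z yX zX|n n12].
- by rewrite (amul0r PR) rpred0.
- by rewrite (amulDr PR) (amulZr PR) rpredD // rpredZ.
rewrite (coord_span xX).
elim/big_ind: _ => [|u v uX vX|i _].
- by rewrite (amul0l PR) rpred0.
- by rewrite (amulDl PR) rpredD.
rewrite (amulZl PR) rpredZ //.
have iws : (i < size ws)%N := ltn_ord i.
rewrite (nth_map [::]) //; set w := nth _ _ _.
have wws : w \in ws by apply: mem_nth.
have /andP[bw Hn] := H w wws.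
have {Hn}/allP Hn := all_iotaP Hn n12.
rewrite -(E_bas idR t n) vmulE //.
set r := vmul _ _ _ in Hn *; set s := vsum _ in Hn.
have -> : E r = E s.
  apply/eqP; rewrite -subr_eq0 -vev_sub; apply/eqP.
  by apply: big1_seq => x' /andP[_ /Hn/pzero_at_pev ->]; rewrite scale0r.
rewrite /s; move: (r) => r'.
have : {subset unzip2 (zip pv ws) <= ws}.
  move=> z /mapP[[a b] /= ab ->]; elim: (pv) (ws) ab => [|p pv' IH] [|w' ws'] //=.
  by rewrite !in_cons => /predU1P[[_ ->]|/IH ->]; rewrite ?eqxx ?orbT.
elim: (zip pv ws) => [|[a b] z IH] /= zws; first by rewrite vev_nil rpred0.
rewrite vev_add vev_scale rpredD ?rpredZ //.
  by apply: mem_span; apply: zws; rewrite mem_head.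
by apply: IH => d dz; apply: zws; rewrite in_cons dz orbT.
Qed.

Lemma dim_span : free_check (q, pv, ws) -> all basic ws ->
  \dim <<X>>%VS = size ws.
Proof.
move=> /andP[/eqP pvs /allP H] /allP bws.
suff : free X by move/eqnP; rewrite size_tuple.
apply/freeP => k k0 i.
have ii : (i : nat) \in iota 0 (size ws) by rewrite mem_iota ltn_ord.
have /andP[p12 /allP Hi] := H i ii.
have := congr1 (fun v : W => v 0 (Ordinal p12)) k0.
rewrite summxE mxE => <-.
transitivity (\sum_j (if i == j then 1 else 0) * k j).
  by rewrite sum_delta mul1r.
apply: eq_bigr => j _; rewrite mxE mulrC; congr (_ * _).
have jj : (j : nat) \in iota 0 (size ws) by rewrite mem_iota ltn_ord.
have jws : nth [::] ws j \in ws by rewrite mem_nth.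
rewrite (nth_map [::]) // -lin_basic ?bws // lin_coord ?bws //.
rewrite (peq_pev idR t (Hi j jj)) pevC val_eqE.
by case: eqP => _; rewrite ?qev1 ?qev0.
Qed.

End SpecialIdeals.

Lemma exists_ideal (R : realType) n (t : R) : (n < 3)%N ->
  t = qev R (ideal_base n).1.1 ->
  exists U : {vspace Mt t}, is_ideal U /\ \dim U = size (ideal_base n).2.
Proof.
move=> n3 ->; have [_ _ H] := checks.
have := all_iotaP H n3; case: (ideal_base n) => [[q pv] ws] /= /andP[Hi Hf].
exists <<[seq vev (idfun : {rmorphism R -> R}) (qev R q)
  (sev (mulM (idfun : {rmorphism R -> R}) (qev R q)) (bvec R)) w | w <- ws]>>%VS.
split; first exact: ideal_span Hi.
apply: dim_span Hf _; apply/allP => w wws.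
by have /allP/(_ w wws)/andP[] := Hi.
Qed.

Theorem theorem5p2 (R : realType) :
  exists (M4A : form_algebra R) (v23 : M4A) (M : R -> real_algebra R),
    is_M4A M4A /\
    type4A_in i2 i3 v23 /\
    (forall t : R,
       specialisation (fa_form (fa_ax M4A (i1, true)) v23) t (M t)) /\
    (forall t : R, \dim {:M t} = 12%N /\ real_monster_axial (M t)) /\
    (forall s t : R, axial_isomorphic (M s) (M t) -> s = t) /\
    (forall t : R, t <> 0 -> t <> 1 / 6 -> t <> 9 / 4 ->
       simple_algebra (M t)) /\
    (forall t : R, t = 0 \/ t = 1 / 6 ->
       exists U : {vspace M t}, is_ideal U /\ \dim U = 3%N) /\
    (forall t : R, t = 9 / 4 ->
       exists U : {vspace M t}, is_ideal U /\ \dim U = 5%N).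
Proof.
exists (M4A R), (v23 R), (@Mt R).
split; first exact: M4A_is_M4A.
split; first exact: v23_type4A.
split; first exact: Mt_specialisation.
split; first by move=> t; split; [exact: dim_Mt | exact: Mt_monster].
split; first exact: axial_isomorphic_eq.
split; first exact: Mt_simple.
split=> [t|t t94].
  case=> tE.
    by apply: (@exists_ideal R 0 t isT); rewrite tE qev0.
  by apply: (@exists_ideal R 1 t isT); rewrite tE; rewrite /qev.
by apply: (@exists_ideal R 2 t isT); rewrite t94; rewrite /qev.
Qed.
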